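(* Let $X$ be an infinite, locally finite, connected graph (multiple edges and loops allowed) in which every vertex has degree at least $2$, and suppose that $X$ is almost transitive. Let $q^{(n)}(x,y)$ be the $n$-step probabilities of non-backtracking random walk on $X$ and $\rho(Q)=\limsup_{n\to\infty}q^{(n)}(x,y)^{1/n}$. Then for all $x,y\in X$, $$\lim_{n\to\infty}q^{(n)}(x,y)/\rho(Q)^n=0,$$ where, if $X$ is a tree (in which case $\rho(Q)=0$ and $q^{(n)}(x,y)=0$ for all sufficiently large $n$), the quotient is read as $0$ whenever $q^{(n)}(x,y)=0$.
   Context: $X$ denotes both the graph and its vertex set. For vertices $x\neq y$, $e(x,y)$ is the number of edges between $x$ and $y$; $e(x,x)$ is twice the number of loops at $x$; $\deg(x)=\sum_y e(x,y)$. To each unoriented edge (including each loop) one associates two oppositely oriented edges $e,\check e$ with $\check{\check e}=e$, $e\ne\check e$; $E=E(X)$ is the set of all oriented edges. $e^-$ and $e^+$ are the initial and terminal vertices of $e$, so $(\check e)^-=e^+$ and $(\check e)^+=e^-$. Write $e\to f$ if $f^-=e^+$ and $f\neq\check e$. Non-backtracking random walk (NBRW): starting at a vertex $x$, the walker chooses uniformly one of the $\deg(x)$ oriented edges with initial vertex $x$ and moves to its terminal vertex; thereafter, having just traversed $e$, he chooses uniformly among the $\deg(e^+)-1$ oriented edges $f$ with $e\to f$ and moves to $f^+$. $q^{(n)}(x,y)$ is the probability that the walker starting at $x$ is at $y$ at the $n$-th step. Equivalently, with $Q_E=(q_E(e,f))_{e,f\in E}$, $q_E(e,f)=1/(\deg(e^+)-1)$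 if $e\to f$ and $0$ otherwise, and $q_E^{(n)}(e,f)$ the entries of $Q_E^n$, one has $q^{(n)}(x,y)=\frac1{\deg(x)}\sum_{e^+=x,\,f^+=y}q_E^{(n)}(e,f)$. The automorphism group of $X$ consists of all bijections $g:X\to X$ with $e(gx,gy)=e(x,y)$ for all $x,y\in X$; $X$ is almost transitive if this group acts on $X$ with finitely many orbits. A tree is required to have no multiple edges (and no loops). Under the present hypotheses the number $\rho(Q)=\limsup_n q^{(n)}(x,y)^{1/n}$ does not depend on $x,y\in X$ (it is positive if $X$ is not a tree, and $0$ if $X$ is a tree). *)

(* Defs.v *)
From HB Require Import structures.
From mathcomp Require Import all_boot all_order all_algebra finmap.
From mathcomp Require Import all_classical all_reals all_analysis.
From Stdlib Require Relations.Relation_Operators.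

Set Implicit Arguments.
Unset Strict Implicit.
Unset Printing Implicit Defensive.

Import Order.TTheory GRing.Theory Num.Theory.
Import numFieldNormedType.Exports.

Local Open Scope classical_set_scope.
Local Open Scope ring_scope.

(* A multigraph, loops allowed, given by its oriented edges: an unoriented
   edge (or loop) is a pair {e, flip e} with flip e <> e. *)
Record multigraph := Multigraph {
  vertex :> choiceType;
  oedge : choiceType;
  src : oedge -> vertex;
  tgt : oedge -> vertex;
  flip : oedge -> oedge;
  flipK : involutive flip;
  flip_neq : forall e, flip e <> e;
  src_flip : forall e, src (flip e) = tgt e }.

Section Graph.
Variable X : multigraph.
Implicit Types (x y : X) (e f : oedge X).

Lemma tgt_flip e : tgt (flip e) = src e.
Proof. by rewrite -src_flip flipK. Qed.

Definition edges_between x y : set (oedge X) :=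
  [set e | src e = x /\ tgt e = y].

Definition out_edges x : set (oedge X) := [set e | src e = x].

Definition in_edges x : set (oedge X) := [set e | tgt e = x].

(* e(x, y); each loop at x has two orientations, so it counts twice in
   e(x, x). *)
Definition nedges x y : nat := #|` fset_set (edges_between x y)|.

(* Equal to the sum of the e(x, y) over y, see [deg_sum]; as [nedges], only
   meaningful in a locally finite graph (fset_set A is empty when A is
   infinite). *)
Definition deg x : nat := #|` fset_set (out_edges x)|.

Definition locally_finite := forall x, finite_set (out_edges x).

Definition connected_graph := forall x y,
  Relation_Operators.clos_refl_trans X
    (fun u v => exists e, src e = u /\ tgt e = v) x y.

Definition automorphism (g : X -> X) :=
  bijective g /\ forall x y, nedges (g x) (g y) = nedges x y.

Definition aut_orbit x : set X := [set y | exists2 g, automorphism g & y = g x].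

Definition almost_transitive := finite_set (range aut_orbit).

(* The relation e -> f of the non-backtracking walk. *)
Definition nb_step e f : bool := (src f == tgt e) && (f != flip e).

End Graph.

Section NBRW.
Variables (R : realType) (X : multigraph).
Implicit Types (x y : X) (e f : oedge X) (n : nat).

Definition qE e f : R :=
  if nb_step e f then ((deg (tgt e))%:R - 1)^-1 else 0.

(* The entries of the n-th power of the matrix (qE e f). The sums below are
   MathComp-Analysis sums over sets, which are the usual ones as soon as the
   support is finite, hence here when X is locally finite. *)
Fixpoint qEn n e f : R :=
  if n is n'.+1 then \sum_(g \in [set: oedge X]) qE e g * qEn n' g f
  else (e == f)%:R.

(* q^(n)(x, y); [nbrw_succ] below expresses it through the first step of the
   walk. *)
Definition nbrw n x y : R :=
  (deg x)%:R^-1 *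
    \sum_(e \in in_edges x) \sum_(f \in in_edges y) qEn n e f.

(* rho(Q), read off at the pair (x, y); the term n = 0 is irrelevant. *)
Definition rhoQ x y : R :=
  limn_sup (fun n : nat => nbrw n x y `^ (n%:R^-1)).

End NBRW.

Section NBRWTheory.
Variables (R : realType) (X : multigraph).
Implicit Types (x y : X) (e f g : oedge X) (n : nat).
Hypothesis Xlf : locally_finite X.

Lemma in_edgesE x : in_edges x = @flip X @` out_edges x.
Proof.
apply/seteqP; split=> [e /= <-|_ [e /= <-] <-]; last exact: tgt_flip.
by exists (flip e); rewrite /out_edges/= ?flipK// src_flip.
Qed.

Lemma finite_in_edges x : finite_set (in_edges x).
Proof. by rewrite in_edgesE; apply: finite_image. Qed.

Lemma fsum_cst (T : choiceType) (V : nmodType) (A : set T) (c : V) :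
  finite_set A -> \sum_(i \in A) c = c *+ #|` fset_set A|.
Proof.
by move=> finA; rewrite fsbig_finite// big_const_seq count_predT iter_addr_0.
Qed.

Lemma deg_sum x : deg x = \sum_(y \in [set: X]) nedges x y.
Proof.
have nedgesE y : nedges x y = \sum_(e \in out_edges x) ((tgt e == y) : nat).
  rewrite -(fsbig_widen (edges_between x y)) => [|e []//|e [/= xe]]; last first.
    by move=> /not_andP[//|/eqP/negPf ->].
  rewrite -[LHS]natn -fsum_cst; last by apply: sub_finite_set (Xlf x) => e [].
  by apply: eq_fsbigr => e; rewrite inE => -[_ /= ->]; rewrite eqxx.
rewrite -(fsbig_widen (@tgt X @` out_edges x))//; last first.
  move=> y [_ /= ny]; rewrite nedgesE fsbig1// => e xe.
  by case: eqP => // ey; case: ny; exists e.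
under eq_fsbigr do rewrite nedgesE.
rewrite exchange_fsbig//; last exact: finite_image.
rewrite -[LHS]natn -fsum_cst//; apply: eq_fsbigr => e; rewrite inE => xe.
rewrite (fsbigD1 (tgt e))//=; [|exact: finite_image|by exists e].
by rewrite eqxx fsbig1 ?addr0// => y [_ /= /eqP]; rewrite eq_sym => /negPf ->.
Qed.

Lemma nbrw_succ n x y : (forall z : X, (2 <= deg z)%N) ->
  nbrw R n.+1 x y = (deg x)%:R^-1 *
    \sum_(e \in out_edges x) \sum_(f \in in_edges y) qEn R n e f.
Proof.
move=> deg2; congr (_ * _).
have fx := finite_in_edges x; have fy := finite_in_edges y.
rewrite exchange_fsbig// [RHS]exchange_fsbig//; apply: eq_fsbigr => f _.
transitivity (\sum_(e \in in_edges x)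
    \sum_(g \in out_edges x) qE R e g * qEn R n g f).
  apply: eq_fsbigr => e; rewrite inE => ex /=.
  apply/esym/fsbig_widen => // g [_ /= gx].
  by rewrite /qE /nb_step ifF ?mul0r//; apply/negP => /andP[/eqP + _]; rewrite ex.
rewrite exchange_fsbig//; apply: eq_fsbigr => g; rewrite inE => gx.
rewrite -mulr_fsuml -[RHS]mul1r; congr (_ * _).
rewrite (fsbigD1 (flip g))//=; last by rewrite /in_edges/= tgt_flip.
rewrite /qE/nb_step flipK eqxx andbF add0r.
transitivity (\sum_(e \in in_edges x `\ flip g) ((deg x)%:R - 1 : R)^-1).
  apply: eq_fsbigr => e; rewrite inE => -[/= ex /eqP neg].
  rewrite ex gx eqxx/= ifT//; apply: contra neg => /eqP ->.
  by rewrite flipK.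
rewrite fsum_cst; last exact: finite_setD.
have -> : #|` fset_set (in_edges x `\ flip g)| = (deg x).-1.
  rewrite fset_setD1// in_edgesE fset_set_image//.
  have -> : deg x = #|` (@flip X @` fset_set (out_edges x))%fset|.
    by rewrite card_imfset//; apply: can_inj (@flipK X).
  rewrite [in RHS](cardfsD1 (flip g)) (_ : flip g \in _)//.
  by apply: in_imfset; rewrite /= in_fset_set// inE.
have -> : (deg x)%:R - 1 = (deg x).-1%:R :> R.
  by rewrite -subn1 natrB// ltnW.
rewrite -[LHS]mulr_natr mulVf// pnatr_eq0.
by case: (deg x) (deg2 x) => [|[]].
Qed.

End NBRWTheory.

(* Main.v *)
Require Import Defs.
From mathcomp Require Import all_boot all_order all_algebra finmap.
From mathcomp Require Import all_classical all_reals all_analysis.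
From mathcomp Require Import ring lra zify.

(** The walk on oriented edges projects to a Markov chain on ordered pairs
    (source, target): from (x, y) it goes to (y, z) with probability
    (e(y, z) - [z = x]) / (deg y - 1), since exactly e(y, z) - [z = x] edges
    from y to z may follow any given edge from x to y ([lumping]). The
    probabilities of this chain are expressions in the numbers e(x, y), so
    vertex automorphisms preserve them ([automorphism_kpow]), whereas on
    oriented edges one would first have to lift each automorphism.

    If rho(Q) = 0 every quotient is 0 for n > 0. If rho(Q) > 0, some pair of
    vertices is joined by walks of two different lengths, which produces a
    non-backtracking closed walk, and then one through each vertex,
    of bounded length by almost transitivity. Consequently the chain of pairs
    is irreducible ([reach_all]): if the walk could never come back along
    an edge e after having traversed it, then infinitely many edges would be
    reachable from e, only one of them entering each vertex, and at a vertex
    far along this branching structure there is no short closed walk.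
    Irreducibility gives K^n(s, s) <= rho(Q)^n for the transition matrix K
    ([kpow_le_rhoQ]), since supermultiplicativity turns a larger return
    probability into a larger exponential growth rate.

    What remains is a statement on a nonnegative matrix, here K / rho(Q), whose
    diagonal powers are bounded by 1 and which has infinitely many indices f_i
    with the same diagonal powers as a given index e ([kpow_vanish]). Such f_i
    exist because some orbit of vertices is infinite. Let A be the limsup of
    a_n = K^n(e, e) / rho(Q)^n, and suppose A > 0. The renewal equation forces,
    as in the Erdos-Feller-Pollard theorem, that a_(N - m) stays close to A
    whenever a_N is close to A and m is a fixed multiple of a possible first
    return time p. Decomposing at first passages then bounds the
    weights of paths of length about N from e to f_i, and back, from below by
    A times the first-passage totals F(e, f_i) and F(f_i, e). Moreover
    F(e, f_i) F(f_i, e) >= 1 ([recurrent_hit]), because A > 0 prevents the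
    paths avoiding f_i from carrying a positive share of the returns to e. Each
    f_i thus contributes at least a fixed amount to the returns to e through
    the f_i at about time 2N; these contributions are bounded in total,
    which is impossible for infinitely many f_i. *)

Set Implicit Arguments.
Unset Strict Implicit.
Unset Printing Implicit Defensive.

Import Order.TTheory GRing.Theory Num.Theory.
Import numFieldNormedType.Exports.
Local Open Scope classical_set_scope.
Local Open Scope ring_scope.

(** * Powers of nonnegative matrices and first passages *)

Section Kernel.
Context (R : realType) (T : eqType) (nb : T -> seq T) (w : T -> T -> R).
Implicit Types (s t r u : T) (n m k : nat).
Hypothesis w_ge0 : forall s t, 0 <= w s t.

Fixpoint kpow n s t : R :=
  if n is m.+1 then \sum_(r <- nb s) w s r * kpow m r t else (s == t)%:R.

(** Total weight of the paths of length n from s to r that avoid t at all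
    times 1, ..., n; the starting point s may be t. *)
Fixpoint taboo t n s r : R :=
  if n is m.+1 then \sum_(u <- nb s | u != t) w s u * taboo t m u r
  else (s == r)%:R.

(** Total weight of the paths of length n from s whose first visit to t at a
    positive time is at time n. *)
Fixpoint fpass t n s : R :=
  if n is m.+1 then
    \sum_(u <- nb s) w s u * (if u == t then (m == 0)%:R else fpass t m u)
  else 0.

Lemma kpow_ge0 n s t : 0 <= kpow n s t.
Proof.
elim: n s => [|n IH] s /=; first exact: ler0n.
by apply: sumr_ge0 => r _; apply: mulr_ge0.
Qed.

Lemma taboo_ge0 t n s r : 0 <= taboo t n s r.
Proof.
elim: n s => [|n IH] s /=; first exact: ler0n.
by apply: sumr_ge0 => u _; apply: mulr_ge0.
Qed.

Lemma fpass_ge0 t n s : 0 <= fpass t n s.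
Proof.
elim: n s => [|n IH] s //=; apply: sumr_ge0 => u _; apply: mulr_ge0 => //.
by case: ifP.
Qed.

(** Paths from s to r either avoid t at positive times, or are cut at their
    first such visit to t. *)
Lemma first_passage t n s r :
  kpow n s r = taboo t n s r +
    \sum_(k < n) fpass t k.+1 s * kpow (n - k.+1) t r.
Proof.
elim: n s => [|n IH] s /=; first by rewrite big_ord0 addr0.
under [X in _ = _ + X]eq_bigr do rewrite mulr_suml.
rewrite exchange_big/= [X in _ = X + _]big_mkcond/= -big_split/=.
apply: eq_bigr => u _; case: eqP => [->|_]/=.
  rewrite add0r big_ord_recl/= mulr1 subSS subn0 big1 ?addr0// => i _.
  by rewrite mulr0 mul0r.
rewrite IH mulrDr; congr (_ + _).
rewrite big_ord_recl/= mulr0 mul0r add0r mulr_sumr; apply: eq_bigr => i _.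
by rewrite mulrA.
Qed.

Lemma taboo_target t n s : taboo t n.+1 s t = 0.
Proof.
elim: n s => [|n IH] s /=; first by rewrite big1// => u /negPf /= ->; rewrite mulr0.
by rewrite big1// => u _; have /= -> := IH u; rewrite mulr0.
Qed.

(** Only an inequality, as paths that are at time n outside of [fs] are
    dropped from the Chapman-Kolmogorov equation. *)
Lemma kpow_cat n m s t (fs : seq T) : uniq fs ->
  \sum_(r <- fs) kpow n s r * kpow m r t <= kpow (n + m) s t.
Proof.
move=> fsu; elim: n s => [|n IH] s.
  rewrite add0n /=; have [sfs|sfs] := boolP (s \in fs).
    rewrite (bigD1_seq s)//= eqxx mul1r big1 ?addr0// => i.
    by rewrite eq_sym => /negPf ->; rewrite mul0r.
  rewrite big1_seq ?kpow_ge0// => i /andP[_ ifs].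
  by case: eqP => [si|_]; [rewrite si ifs in sfs|rewrite mul0r].
rewrite addSn /=; under eq_bigr do rewrite mulr_suml.
rewrite exchange_big/=; apply: ler_sum => u _.
under eq_bigr do rewrite -mulrA.
by rewrite -mulr_sumr; apply: ler_wpM2l.
Qed.

Lemma kpow_cat1 n m s r t : kpow n s r * kpow m r t <= kpow (n + m) s t.
Proof. by have := @kpow_cat n m s t [:: r] isT; rewrite big_seq1. Qed.

(** A path avoiding t followed by a path with first passage at t is a path
    with first passage at t, and n fixes the place of the cut. *)
Lemma taboo_fpass t n m s r :
  taboo t n s r * fpass t m.+1 r <= fpass t (n + m.+1) s.
Proof.
elim: n s => [|n IH] s.
  rewrite add0n; change (taboo t 0 s r) with ((s == r)%:R : R).
  by case: eqP => [->|_]; rewrite ?mul1r// mul0r fpass_ge0.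
rewrite addSn.
change (taboo t n.+1 s r) with (\sum_(u <- nb s | u != t) w s u * taboo t n u r).
change (fpass t (n + m.+1).+1 s) with (\sum_(u <- nb s) w s u *
  (if u == t then ((n + m.+1)%N == 0)%:R else fpass t (n + m.+1) u)).
rewrite mulr_suml big_mkcond/=; apply: ler_sum => u _; case: eqP => [_|_]/=.
  by rewrite addnS/= mulr0.
by rewrite -mulrA; apply: ler_wpM2l.
Qed.

End Kernel.

(** * Renewal sequences *)

(** The index shift makes [a = conv u a] at positive indices the renewal
    equation in which [u k] is the weight of a return after k + 1 steps. *)
Definition conv (R : realType) (c a : nat -> R) n : R :=
  \sum_(k < n) c k * a (n - k.+1)%N.

Section Renewal.
Variable R : realType.
Implicit Types (a c u : nat -> R) (N : nat -> nat).

Lemma near_subseq N (P : nat -> Prop) :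
    (forall m, \forall j \near \oo, (m <= N j)%N) ->
  (\forall n \near \oo, P n) -> \forall j \near \oo, P (N j).
Proof.
move=> Noo [m _ mP]; have := Noo m.
by apply: filterS => j; exact: mP.
Qed.

Lemma series_nd c n m : (forall k, 0 <= c k) -> (n <= m)%N ->
  series c n <= series c m.
Proof.
move=> c0 nm; rewrite -subr_ge0 sub_series_geq//; exact: sumr_ge0.
Qed.

Lemma series_le_lim c (S : R) n : (forall k, 0 <= c k) ->
  series c @ \oo --> S -> series c n <= S.
Proof.
move=> c0 cS; rewrite -(cvg_lim (@Rhausdorff R) cS).
apply: nondecreasing_cvgn_le; last by apply/cvg_ex; exists S.
by move=> ? ?; exact: series_nd.
Qed.

(** The terms with k < K see only late values of [a]; all the others are
    controlled by the tail d of the series. *)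
Lemma conv_le c a (S M d B : R) n0 K n : (forall k, 0 <= c k) ->
    (forall k, series c k <= S) ->
    (forall m, 0 <= a m <= M) -> (forall m, (n0 <= m)%N -> a m <= B) ->
    S - d <= series c K -> (n0 + K <= n)%N ->
  conv c a n <= S * B + M * d.
Proof.
move=> c0 cS aM aB cK n0K; have Kn : (K <= n)%N by lia.
have B0 : 0 <= B.
  by have /andP[h _] := aM n0; apply: le_trans h (aB _ _).
rewrite /conv -(big_mkord xpredT (fun k => c k * a (n - k.+1)%N)).
rewrite (big_cat_nat (n := K))//=; apply: lerD.
  apply: (@le_trans _ _ (series c K * B)); last exact: ler_wpM2r.
  rewrite /series/= mulr_suml; apply: ler_sum_nat => k kK.
  by apply: ler_wpM2l => //; apply: aB; lia.
apply: (@le_trans _ _ ((series c n - series c K) * M)).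
  rewrite sub_series_geq// mulr_suml; apply: ler_sum_nat => k kK.
  by apply: ler_wpM2l => //; have /andP[] := aM (n - k.+1)%N.
rewrite mulrC; apply: ler_wpM2l; first by have /andP[]:= aM 0%N; apply: le_trans.
by have := cS n; lra.
Qed.

Lemma conv_limsup c a (S M B : R) : (forall k, 0 <= c k) ->
    series c @ \oo --> S -> (forall m, 0 <= a m <= M) ->
    (forall e, 0 < e -> \forall n \near \oo, a n <= B + e) ->
  forall e, 0 < e -> \forall n \near \oo, conv c a n <= S * B + e.
Proof.
move=> c0 cS aM aB e e0.
have S0 : 0 <= S by have := series_le_lim 0 c0 cS; rewrite /series/= big_geq.
have M0 : 0 <= M by have /andP[] := aM 0%N; apply: le_trans.
pose d := e / (S + M + 1).
have d0 : 0 < d by rewrite divr_gt0//; lra.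
have /cvgrPdist_le /(_ _ d0) [K _ KP] := cS.
have [n0 _ n0P] := aB _ d0.
exists (n0 + K)%N => // n /= n0K.
have cSK k : series c k <= S by exact: series_le_lim.
have SK : S - d <= series c K.
  have /= := KP K (leqnn K); rewrite ger0_norm ?subr_ge0//; lra.
apply: le_trans (conv_le (d := d) c0 cSK aM n0P SK n0K) _.
rewrite mulrDr -addrA lerD2l -mulrDl /d mulrCA ger_pMr// ler_pdivrMr; lra.
Qed.

Lemma conv_remove c a p n : (p < n)%N ->
  conv c a n = c p * a (n - p.+1)%N +
    conv (fun k => if k == p then 0 else c k) a n.
Proof.
move=> pn; rewrite /conv (bigD1 (Ordinal pn))//=; congr (_ + _).
rewrite [RHS](bigD1 (Ordinal pn))//= eqxx mul0r add0r.
apply: eq_bigr => i ip; rewrite ifF//; apply: contraNF ip => /eqP ip.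
by apply/eqP/val_inj.
Qed.

Lemma series_remove c p (S : R) : series c @ \oo --> S ->
  series (fun k => if k == p then 0 else c k) @ \oo --> S - c p.
Proof.
move=> cS.
have -> : series (fun k => if k == p then 0 else c k) =
    (fun n => series c n - (if (p < n)%N then c p else 0)).
  apply/funext => n; rewrite /series/=; elim: n => [|n IH].
    by rewrite !big_geq// subr0.
  rewrite !big_nat_recr//= IH ltnS (leq_eqVlt p) eq_sym.
  case: eqP => [->|_]/=; last by rewrite addrAC.
  by rewrite ltnn; lra.
apply: cvgB => //; apply: (@cvg_near_cst _ _ (c p)).
by exists p.+1 => // n /= ->.
Qed.

(** The Erdos-Feller-Pollard argument: a_N is an average, of total mass at
    most 1, of earlier values, which are asymptotically at most A. If a_N is
    close to A, then each earlier value of positive mass has to be close to A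
    too. *)
Lemma renewal_shift a u (A S : R) p N :
    (forall k, 0 <= u k) -> (forall n, 0 <= a n <= 1) ->
    (forall n, a n.+1 = conv u a n.+1) ->
    series u @ \oo --> S -> S <= 1 -> 0 < u p -> 0 <= A ->
    (forall e, 0 < e -> \forall n \near \oo, a n <= A + e) ->
    (forall m, \forall j \near \oo, (m <= N j)%N) ->
    (forall e, 0 < e -> \forall j \near \oo, A - e <= a (N j)) ->
  forall e, 0 < e -> \forall j \near \oo, A - e <= a (N j - p.+1)%N.
Proof.
move=> u0 a01 ren uS S1 up A0 limA Noo limN e e0.
pose c k := if k == p then 0 else u k.
have c0 k : 0 <= c k by rewrite /c; case: ifP.
pose d := e * u p / 2.
have d0 : 0 < d by rewrite divr_gt0// mulr_gt0.
have h1 : \forall j \near \oo, conv c a (N j) <= (S - u p) * A + d.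
  apply: (near_subseq (P := fun n => conv c a n <= (S - u p) * A + d) Noo).
  exact: (conv_limsup c0 (series_remove (p:=p) uS) a01 limA d0).
have h2 : \forall j \near \oo, (p < N j)%N by exact: (Noo p.+1).
near=> j; have pN : (p < N j)%N by near: j.
rewrite -(ler_pM2l up).
have c1 : conv c a (N j) <= (S - u p) * A + d by near: j.
have a1 : A - d <= a (N j) by near: j; exact: limN.
have aN : a (N j) = u p * a (N j - p.+1)%N + conv c a (N j).
  by rewrite -(conv_remove u a pN) -(prednK (leq_ltn_trans (leq0n p) pN)) ren.
have SA : S * A <= A by rewrite ler_piMl.
rewrite aN in a1; rewrite mulrBr; move: c1; rewrite mulrBl => c1.
have : d = u p * e / 2 by rewrite /d (mulrC e).
lra.
Unshelve. all: by end_near. Qed.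

Lemma renewal_shift_iter a u (A S : R) p N :
    (forall k, 0 <= u k) -> (forall n, 0 <= a n <= 1) ->
    (forall n, a n.+1 = conv u a n.+1) ->
    series u @ \oo --> S -> S <= 1 -> 0 < u p -> 0 <= A ->
    (forall e, 0 < e -> \forall n \near \oo, a n <= A + e) ->
    (forall m, \forall j \near \oo, (m <= N j)%N) ->
    (forall e, 0 < e -> \forall j \near \oo, A - e <= a (N j)) ->
  forall q e, 0 < e -> \forall j \near \oo, A - e <= a (N j - q * p.+1)%N.
Proof.
move=> u0 a01 ren uS S1 up A0 limA Noo limN; elim=> [|q IH] e e0.
  by under eq_near do rewrite mul0n subn0; exact: limN.
under eq_near do rewrite mulSn addnC subnDA.
apply: (renewal_shift u0 a01 ren uS S1 up A0 limA _ IH e0) => m.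
have := Noo (m + q * p.+1)%N.
by apply: filterS => j nj; lia.
Qed.

(** The shift k need not be a multiple of the return time p + 1, but one of
    any p + 1 consecutive shifts is; summing over windows of this length
    avoids all considerations of periodicity. *)
Lemma renewal_window a u (A S : R) p N :
    (forall k, 0 <= u k) -> (forall n, 0 <= a n <= 1) ->
    (forall n, a n.+1 = conv u a n.+1) ->
    series u @ \oo --> S -> S <= 1 -> 0 < u p -> 0 <= A ->
    (forall e, 0 < e -> \forall n \near \oo, a n <= A + e) ->
    (forall m, \forall j \near \oo, (m <= N j)%N) ->
    (forall e, 0 < e -> \forall j \near \oo, A - e <= a (N j)) ->
  forall k e, 0 < e ->
    \forall j \near \oo, A - e <= \sum_(s < p.+1) a (N j + s - k)%N.
Proof.
move=> u0 a01 ren uS S1 up A0 limA Noo limN k e e0.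
have h1 := renewal_shift_iter u0 a01 ren uS S1 up A0 limA Noo limN (k %/ p.+1) e0.
have h2 : \forall j \near \oo, (k < N j)%N by exact: (Noo k.+1).
near=> j; have kN : (k < N j)%N by near: j.
have hj : A - e <= a (N j - (k %/ p.+1) * p.+1)%N by near: j.
apply: le_trans hj _.
rewrite (bigD1 (Ordinal (ltn_pmod k (ltn0Sn p))))//=.
have -> : (N j - k %/ p.+1 * p.+1 = N j + k %% p.+1 - k)%N.
  by have := divn_eq k p.+1; lia.
by rewrite lerDl; apply: sumr_ge0 => i _; have /andP[] := a01 (N j + i - k)%N.
Unshelve. all: by end_near. Qed.

Lemma conv_window c a (C : R) p N K :
    (forall k, 0 <= c k) -> (forall n, 0 <= a n) ->
    (forall m, \forall j \near \oo, (m <= N j)%N) ->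
    (forall k, \forall j \near \oo, C <= \sum_(s < p) a (N j + s - k)%N) ->
  \forall j \near \oo, series c K * C <= \sum_(s < p) conv c a (N j + s)%N.
Proof.
move=> c0 a0 Noo win.
have h1 : \forall j \near \oo,
    forall k : 'I_K, C <= \sum_(s < p) a (N j + s - k.+1)%N.
  by apply: filter_forall => k; exact: win.
have h2 : \forall j \near \oo, (K <= N j)%N by exact: (Noo K).
near=> j; have KN : (K <= N j)%N by near: j.
have winj : forall k : 'I_K, C <= \sum_(s < p) a (N j + s - k.+1)%N by near: j.
rewrite /series/= big_mkord mulr_suml.
apply: (@le_trans _ _ (\sum_(k < K) c k * \sum_(s < p) a (N j + s - k.+1)%N)).
  by apply: ler_sum => k _; exact: ler_wpM2l.
under [X in X <= _]eq_bigr do rewrite mulr_sumr.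
rewrite exchange_big/=; apply: ler_sum => s _; rewrite /conv.
have KNs : (K <= N j + s)%N by lia.
rewrite -(big_mkord xpredT (fun k => c k * a (N j + s - k.+1)%N)).
rewrite -[X in _ <= X](big_mkord xpredT (fun k => c k * a (N j + s - k.+1)%N)).
rewrite [X in _ <= X](big_cat_nat (n := K))//= lerDl.
by apply: sumr_ge0 => k _; exact: mulr_ge0.
Unshelve. all: by end_near. Qed.

Lemma bernoulli_ineq (h : R) n : 0 <= h -> 1 + n%:R * h <= (1 + h) ^+ n.
Proof.
move=> h0; elim: n => [|n IH]; first by rewrite mul0r addr0.
rewrite exprS; apply: (@le_trans _ _ ((1 + h) * (1 + n%:R * h))).
  rewrite -natr1; have : 0 <= n%:R * h * h by rewrite !mulr_ge0.
  lra.
by apply: ler_wpM2l => //; lra.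
Qed.

(** The linear lower bound of Bernoulli's inequality for V ^ j becomes a
    quadratic one for V ^ (2 j). *)
Lemma exp_not_le_linear (V D : R) : 1 < V ->
  (forall j, V ^+ j <= D * j.+1%:R) -> False.
Proof.
move=> V1 VD; pose h := V - 1; have h0 : 0 < h by rewrite subr_gt0.
have D1 : 1 <= D by have := VD 0%N; rewrite expr0 mulr1.
have D2 : 0 <= 3 * D / h ^+ 2 by rewrite divr_ge0// ?exprn_ge0; lra.
have := archi_boundP D2; set j := Num.bound _ => jD.
have := VD (j + j)%N; rewrite exprD => VDj.
have := bernoulli_ineq j (ltW h0).
have -> : 1 + h = V by rewrite /h; lra.
move=> Bj; have j0 : 0 < j%:R :> R by exact: le_lt_trans jD.
have j1 : 1 <= j%:R :> R by rewrite ler1n -(ltr0n R).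
have jh : 0 < j%:R * h by rewrite mulr_gt0.
have : (1 + j%:R * h) * (1 + j%:R * h) <= V ^+ j * V ^+ j.
  by apply: ler_pM => //; lra.
move: jD; rewrite ltr_pdivrMr ?exprn_gt0// => jD.
have : 3 * D * j%:R < j%:R * h ^+ 2 * j%:R by rewrite ltr_pM2r.
have -> : j%:R * h ^+ 2 * j%:R = (j%:R * h) * (j%:R * h) by ring.
have : D <= D * j%:R by rewrite ler_peMr//; lra.
move: VDj; rewrite -addn1 !natrD mulrDr; lra.
Qed.

(** A total return weight larger than 1 would make the partial sums of [a]
    grow exponentially, while [a <= 1] bounds them linearly. *)
Lemma renewal_sum_le1 a u n : (forall k, 0 <= u k) ->
  (forall n, 0 <= a n <= 1) -> a 0%N = 1 ->
  (forall n, a n.+1 = conv u a n.+1) -> series u n <= 1.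
Proof.
move=> u0 a01 a0 ren; rewrite leNgt; apply/negP => V1.
have sE m : series a m.+1 = 1 + conv u (series a) m.+1.
  elim: m => [|m IH]; rewrite /conv.
    by rewrite big_ord1 /series/= big_nat1 a0 big_geq// mulr0 addr0.
  rewrite seriesSr IH ren -addrA; congr (_ + _).
  rewrite /conv [in RHS]big_ord_recr/= subnn [X in _ * series a X]/=.
  rewrite {3}/series/= big_geq// mulr0 addr0 -big_split/=.
  apply: eq_bigr => k _; rewrite -mulrDr -seriesSr !subSS subSn//.
  by rewrite -ltnS.
have s0 k : 0 <= series a k.
  by apply: sumr_ge0 => i _; have /andP[]:= a01 i.
have sS m : series u n * series a m <= series a (m + n.+1)%N.
  rewrite addnS sE; apply: (@le_trans _ _ (conv u (series a) (m + n).+1)); last by lra.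
  rewrite /conv -(big_mkord xpredT (fun k => u k * series a ((m + n).+1 - k.+1)%N)).
  rewrite (big_cat_nat (n := n))//=; last by lia.
  rewrite -[X in X <= _]addr0; apply: lerD.
    rewrite {1}/series/= mulr_suml; apply: ler_sum_nat => k kn.
    apply: ler_wpM2l => //; apply: series_nd; last by lia.
    by move=> i; have /andP[]:= a01 i.
  by apply: sumr_ge0 => k _; exact: mulr_ge0.
apply: (@exp_not_le_linear _ n.+1%:R V1) => j.
apply: (@le_trans _ _ (series a (j * n.+1).+1)).
  elim: j => [|j IH]; first by rewrite expr0 mul0n /series/= big_nat1 a0.
  rewrite exprS; apply: (@le_trans _ _ (series u n * series a (j * n.+1).+1)).
    by apply: ler_wpM2l => //; lra.
  by apply: le_trans (sS _) _; rewrite mulSn addSn addnC.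
apply: (@le_trans _ _ (\sum_(0 <= i < (j * n.+1).+1) 1)).
  by apply: ler_sum_nat => i _; have /andP[]:= a01 i.
by rewrite big_const_nat iter_addr_0 subn0 -natrM ler_nat; lia.
Qed.
End Renewal.

(** * Vanishing of diagonal powers *)

Section Limsup.
Variable R : realType.
Implicit Types (a : nat -> R).

(** A is the limsup of [a], and [a] tends to A along N. Since A bounds [a]
    asymptotically from above, only the lower bound along N is recorded. *)
Lemma limsup_subseq a : (forall n, 0 <= a n <= 1) -> ~ (a @ \oo --> (0 : R)) ->
  exists A : R, exists N : nat -> nat, [/\ 0 < A,
    forall e, 0 < e -> \forall n \near \oo, a n <= A + e,
    forall m, \forall j \near \oo, (m <= N j)%N &
    forall e, 0 < e -> \forall j \near \oo, A - e <= a (N j)].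
Proof.
move=> a01 an0.
(* The numbers that a reaches or exceeds infinitely often have the limsup as
   supremum. *)
pose E : set R := [set x | forall n, exists2 m, (n <= m)%N & x <= a m].
have [x x0 Ex] : exists2 x, 0 < x & E x.
  apply: contrapT => nE; apply: an0; apply/cvgrPdist_le => e e0.
  have nEe : ~ E e by move=> Ee; apply: nE; exists e.
  move/existsNP : nEe => [n /forall2NP nP].
  exists n => // m /= nm; rewrite sub0r normrN ger0_norm; last by have /andP[]:= a01 m.
  by have [//|/negP] := nP m; rewrite -ltNge => /ltW.
have supE : has_sup E.
  split; first by exists x.
  by exists 1 => y /(_ 0%N)[m _ ym]; apply: le_trans ym _; have /andP[]:= a01 m.
have freq e : 0 < e -> forall n, exists2 m, (n <= m)%N & sup E - e <= a m.
  move=> e0 n; have [y Ey /ltW ye] := sup_adherent e0 supE.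
  have [m nm ym] := Ey n; exists m => //; exact: le_trans ye ym.
have /choice[N NP] : forall j : nat, exists m, (j <= m)%N /\
    sup E - j.+1%:R^-1 <= a m.
  move=> j; have [|m jm mP] := freq j.+1%:R^-1 _ j; first by rewrite invr_gt0.
  by exists m.
exists (sup E), N; split.
- by apply: lt_le_trans x0 _; apply: ub_le_sup => //; case: supE.
- move=> e e0; apply: contrapT => nP.
  have : E (sup E + e).
    move=> n; apply: contrapT => /forall2NP mP; apply: nP.
    exists n => // m /= nm; have [//|/negP] := mP m.
    by rewrite -ltNge => /ltW.
  by move/(ub_le_sup (proj2 supE)); lra.
- by move=> m; exists m => // j /= mj; apply: leq_trans mj (proj1 (NP j)).
- move=> e e0; near=> j; apply: le_trans (proj2 (NP j)).
  rewrite lerD2l lerN2; apply: ltW; near: j.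
  exact: near_infty_natSinv_lt (PosNum e0).
Unshelve. all: by end_near. Qed.

End Limsup.

Section Vanishing.
Context (R : realType) (T : eqType) (nb : T -> seq T) (w : T -> T -> R).
Hypothesis w_ge0 : forall s t, 0 <= w s t.
Local Notation K := (kpow nb w).
Local Notation F t s := (fun k => fpass nb w t k.+1 s).

Lemma renewal_eq t s n : K n.+1 s t = conv (F t s) (fun m => K m t t) n.+1.
Proof. by rewrite (first_passage nb w t) taboo_target add0r. Qed.

Lemma fpass_loop_le1 t n : (forall n, K n t t <= 1) -> series (F t t) n <= 1.
Proof.
move=> K1; apply: (@renewal_sum_le1 R (fun m => K m t t)).
- by move=> k; exact: fpass_ge0.
- by move=> m; rewrite kpow_ge0/=.
- by rewrite /= eqxx.
- by move=> m; exact: renewal_eq.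
Qed.

(** Cut a path from t to r at its last visit to t; equivalently, take a
    shortest path. *)
Lemma taboo_reach t r n : t != r -> 0 < K n t r ->
  exists l, 0 < taboo nb w t l t r.
Proof.
move=> tr; elim/ltn_ind: n => n IH Kn.
have := taboo_ge0 nb w_ge0 t n t r; rewrite le_eqVlt => /orP[/eqP h0|]; last by exists n.
move: Kn; rewrite (first_passage nb w t) -h0 add0r => Kn.
have [k kP] : exists k : 'I_n, 0 < K (n - k.+1)%N t r.
  apply: contrapT => /forallNP kP; move: Kn; rewrite big1 ?ltxx// => k _.
  have := kpow_ge0 nb w_ge0 (n - k.+1)%N t r.
  by rewrite le_eqVlt => /orP[/eqP <-|/kP//]; rewrite mulr0.
by apply: IH kP; have := ltn_ord k; lia.
Qed.

Lemma fpass_reachS t s n : 0 < K n.+1 s t -> exists m, 0 < F t s m.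
Proof.
rewrite renewal_eq => Kn; apply: contrapT => /forallNP mP.
move: Kn; rewrite /conv big1 ?ltxx// => k _.
have := fpass_ge0 nb w_ge0 t k.+1 s.
by rewrite le_eqVlt => /orP[/eqP <-|/mP//]; rewrite mul0r.
Qed.

Lemma fpass_reach t s n : s != t -> 0 < K n s t -> exists m, 0 < F t s m.
Proof.
by case: n => [/= /negPf ->|n _]; [rewrite ltxx|exact: fpass_reachS].
Qed.

Lemma renewal_eq_neq t s n : s != t ->
  K n s t = conv (F t s) (fun m => K m t t) n.
Proof.
case: n => [/= /negPf ->|n _]; last exact: renewal_eq.
by rewrite /conv big_ord0.
Qed.

(** Prepending a fixed path from t to s that avoids t turns first passages
    from s to t into first returns to t, and these have total weight at most
    1. *)
Lemma fpass_cvg t s n : s != t -> 0 < K n t s -> (forall n, K n t t <= 1) ->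
  cvgn (series (F t s)).
Proof.
move=> st Kts K1; have [|l l0] := taboo_reach _ Kts; first by rewrite eq_sym.
apply: nondecreasing_is_cvgn.
  by move=> i j ij; apply: series_nd ij => k; exact: fpass_ge0.
exists (taboo nb w t l t s)^-1 => _ [j _ <-].
rewrite -div1r ler_pdivlMr// mulrC.
apply: le_trans (@fpass_loop_le1 t (l + j)%N K1).
apply: (@le_trans _ _ (series (F t t) (l + j)%N - series (F t t) l)).
  rewrite sub_series_geq ?leq_addr// -[X in \sum_(X <= _ < _) _]add0n big_addn addKn.
  rewrite /series/= mulr_sumr; apply: ler_sum => k _.
  by have := taboo_fpass nb w_ge0 t l k t s; rewrite addnS addnC.
by rewrite lerBlDr lerDl; apply: sumr_ge0 => k _; exact: fpass_ge0.
Qed.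

(** Appending a fixed first-passage path from s to t bounds these weights by
    the general term of a convergent series. *)
Lemma taboo_cvg0 t s n : s != t -> 0 < K n s t -> cvgn (series (F t s)) ->
  (fun n => taboo nb w t n s s) @ \oo --> (0 : R).
Proof.
move=> st Kst Fc; have [m m0] := fpass_reach st Kst.
have F0 : (fun n => F t s (n + m)%N / F t s m) @ \oo --> (0 : R).
  rewrite -(mul0r (F t s m)^-1); apply: cvgMl.
  by rewrite (cvg_shiftn m (F t s)); exact: cvg_series_cvg_0.
apply: (squeeze_cvgr _ (cvg_cst 0) F0); apply: nearW => k.
rewrite taboo_ge0//= ler_pdivlMr//.
by have := taboo_fpass nb w_ge0 t k m s s; rewrite addnS.
Qed.

(** The weight of the returns to s avoiding t tends to 0, so in the limit
    along N all returns are made of a first passage to t, a first passage back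
    to s, and a return of s; the weight A of the returns is thus at most S *
    S' * A. *)
Lemma recurrent_hit s t (A : R) (N : nat -> nat) n m (S S' : R) : s != t ->
    0 < K n s t -> 0 < K m t s ->
    (forall n, K n s s <= 1) -> (forall n, K n t t <= 1) -> 0 < A ->
    (forall e, 0 < e -> \forall n \near \oo, K n s s <= A + e) ->
    (forall m, \forall j \near \oo, (m <= N j)%N) ->
    (forall e, 0 < e -> \forall j \near \oo, A - e <= K (N j) s s) ->
    series (F t s) @ \oo --> S -> series (F s t) @ \oo --> S' ->
  1 <= S * S'.
Proof.
move=> st Kst Kts Ks1 Kt1 A0 limA Noo limN FS FS'.
have F0 t' s' k : 0 <= F t' s' k by exact: fpass_ge0.
have Fts : cvgn (series (F t s)) by apply/cvg_ex; exists S.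
have KtsE k := @renewal_eq_neq s t k.
have lim1 : forall e, 0 < e -> \forall n \near \oo, K n t s <= S' * A + e.
  move=> e e0; under eq_near do rewrite KtsE 1?eq_sym//.
  apply: (conv_limsup (F0 s t) FS' (M := 1)) => // k.
  by rewrite kpow_ge0/=.
have Kbd k : 0 <= K k t s <= (K n s t)^-1.
  rewrite kpow_ge0//= -div1r ler_pdivlMr//.
  exact: le_trans (kpow_cat1 nb w_ge0 _ _ _ _ _) (Kt1 _).
have lim2 := conv_limsup (F0 t s) FS Kbd lim1.
have lim3 := taboo_cvg0 st Kst Fts.
suff : A <= S * (S' * A) by rewrite mulrA -{1}(mul1r A) ler_pM2r.
apply/ler_addgt0Pr => e e0.
pose d := e / 3; have d0 : 0 < d by rewrite divr_gt0.
have h3 : \forall n \near \oo, taboo nb w t n s s <= d.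
  move/cvgrPdist_le : lim3 => /(_ _ d0); apply: filterS => k.
  by rewrite sub0r normrN ger0_norm// taboo_ge0.
have h2 := near_subseq (P := fun n => _ <= _) Noo (lim2 _ d0).
have {}h3 := near_subseq (P := fun n => _ <= _) Noo h3.
have h1 := limN _ d0.
near \oo => j.
have a1 : A - d <= K (N j) s s by near: j.
have a2 : conv (F t s) (fun k => K k t s) (N j) <= S * (S' * A) + d by near: j.
have a3 : taboo nb w t (N j) s s <= d by near: j.
move: a1; rewrite (first_passage nb w t) -/(conv (F t s) (fun k => K k t s) (N j)).
have : e = d + d + d by rewrite /d; field.
by move: a2 a3; lra.
Unshelve. all: by end_near. Qed.

(** X i j and Y i j below are the weights of the paths from e to [f i] and
    back, summed over windows of p + 1 lengths starting at N j. For every i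
    their product is eventually at least A ^ 2 / 8: first passages between e
    and [f i] have product of totals at least 1, hence at least 1 / 2 for
    partial sums, and returns over a window weigh at least A / 2. For M
    distinct indices i the sum of the products is at most the number of pairs
    of lengths, because each such pair yields returns to e of one single
    length. *)
Theorem kpow_vanish e (f : nat -> T) : injective f ->
    (forall i, e != f i) -> (forall i n, K n (f i) (f i) = K n e e) ->
    (forall n, K n e e <= 1) ->
    (forall i, exists n, 0 < K n e (f i)) ->
    (forall i, exists n, 0 < K n (f i) e) ->
  (fun n => K n e e) @ \oo --> (0 : R).
Proof.
move=> finj ef Kf K1 e2f f2e; apply: contrapT => Kn0.
have K01 n : 0 <= K n e e <= 1 by rewrite kpow_ge0/=.
have [A [N [A0 limA Noo limN]]] := limsup_subseq K01 Kn0.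
have F0 t s k : 0 <= F t s k by exact: fpass_ge0.
have Fee : cvgn (series (F e e)).
  apply: nondecreasing_is_cvgn; first by move=> i j ij; exact: series_nd ij.
  by exists 1 => _ [n _ <-]; exact: fpass_loop_le1.
have Fee1 : limn (series (F e e)) <= 1.
  by apply: limr_le => //; apply: nearW => n; exact: fpass_loop_le1.
have [p p0] : exists p, 0 < F e e p.
  have A2 : 0 < A / 2 by rewrite divr_gt0.
  near \oo => j.
  have Kj : A - A / 2 <= K (N j) e e by near: j; exact: limN.
  have : (1 <= N j)%N by near: j; exact: Noo.
  case: (N j) Kj => // n Kn _; apply: (@fpass_reachS _ _ n).
  by apply: lt_le_trans Kn; lra.
have win k := @renewal_window _ _ _ A _ p N (F0 e e) K01 (renewal_eq e e) Fee Fee1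
  p0 (ltW A0) limA Noo limN k (A / 2) (divr_gt0 A0 (ltr0n _ 2)).
have AA : A - A / 2 = A / 2 by lra.
rewrite AA in win.
pose X i j := \sum_(s < p.+1) K (N j + s) e (f i).
pose Y i j := \sum_(s < p.+1) K (N j + s) (f i) e.
have XY i : \forall j \near \oo, A ^+ 2 / 8 <= X i j * Y i j.
  have [n n0] := e2f i; have [m m0] := f2e i.
  have Kf1 k : K k (f i) (f i) <= 1 by rewrite Kf.
  have S1 := fpass_cvg (ef i) m0 Kf1.
  have fe : f i != e by rewrite eq_sym.
  have S2 := fpass_cvg fe n0 K1.
  have SS := recurrent_hit (ef i) n0 m0 K1 Kf1 A0 limA Noo limN S1 S2.
  have : (fun k => series (F (f i) e) k * series (F e (f i)) k) @ \oo -->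
    limn (series (F (f i) e)) * limn (series (F e (f i))) by exact: cvgM.
  move/cvgrPdist_le => /(_ (1 / 2)) [|k _ /(_ k (leqnn k))/= kP]; first lra.
  have kP2 : 1 / 2 <= series (F (f i) e) k * series (F e (f i)) k.
    by move: kP; rewrite ler_norml => /andP[_]; lra.
  have a0 q : 0 <= K q e e by exact: kpow_ge0.
  have w1 := conv_window k (F0 (f i) e) a0 Noo win.
  have w2 := conv_window k (F0 e (f i)) a0 Noo win.
  near=> j.
  have X1 : series (F (f i) e) k * (A / 2) <= X i j.
    rewrite /X; under eq_bigr do rewrite renewal_eq_neq//.
    by rewrite (funext (Kf i)); near: j.
  have Y1 : series (F e (f i)) k * (A / 2) <= Y i j.
    by rewrite /Y; under eq_bigr do rewrite renewal_eq_neq//; near: j.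
  have sr0 t s : 0 <= series (F t s) k by exact: sumr_ge0.
  apply: (@le_trans _ _ ((series (F (f i) e) k * (A / 2)) * (series (F e (f i)) k * (A / 2)))).
    by rewrite mulrACA; nra.
  by apply: ler_pM => //; rewrite mulr_ge0// divr_ge0// ltW.
pose P : R := (p.+1 * p.+1)%:R.
have P0 : 0 <= P / (A ^+ 2 / 8) by rewrite divr_ge0// ?ler0n// divr_ge0// exprn_ge0// ltW.
have := archi_boundP P0; set M := Num.bound _ => PM.
have XYM : \forall j \near \oo, forall i : 'I_M, A ^+ 2 / 8 <= X i j * Y i j.
  by apply: filter_forall => i; exact: XY.
near \oo => j.
have XYj : forall i : 'I_M, A ^+ 2 / 8 <= X i j * Y i j by near: j.
have low : M%:R * (A ^+ 2 / 8) <= \sum_(i < M) X i j * Y i j.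
  rewrite -[M in M%:R](card_ord M) -sum1_card natr_sum mulr_suml.
  by apply: ler_sum => i _; rewrite mul1r.
have up : \sum_(i < M) X i j * Y i j <= P.
  rewrite /X /Y; under eq_bigr do rewrite big_distrlr/=.
  rewrite exchange_big/=; under eq_bigr do rewrite exchange_big/=.
  apply: (@le_trans _ _ (\sum_(s < p.+1) \sum_(s' < p.+1) 1)).
    apply: ler_sum => s _; apply: ler_sum => s' _.
    have fu : uniq (map f (iota 0 M)) by rewrite map_inj_uniq// iota_uniq.
    apply: le_trans (K1 (N j + s + (N j + s'))%N).
    apply: le_trans (kpow_cat nb w_ge0 _ _ _ _ fu).
    by rewrite big_map -[iota _ _]/(index_iota 0 M) big_mkord.
  by rewrite !sumr_const !card_ord /P natrM mulr_natr.
move: PM; rewrite ltr_pdivrMr; first lra.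
by rewrite divr_gt0// exprn_gt0.
Unshelve. all: by end_near. Qed.

End Vanishing.

(** * The chain of ordered pairs *)

Lemma big_fiber (V : nmodType) (I J : eqType) (r : seq I) (ks : seq J) (h : I -> J)
    (P : I -> V) : uniq ks -> {in r, forall i, h i \in ks} ->
  \sum_(i <- r) P i = \sum_(k <- ks) \sum_(i <- r | h i == k) P i.
Proof.
move=> ksu hr; rewrite (exchange_big_dep xpredT)//= !big_seq.
apply: eq_bigr => i ir; rewrite -big_filter.
have -> : [seq k <- ks | h i == k] = [:: h i].
  rewrite -(filter_pred1_uniq ksu (hr _ ir)).
  by apply: eq_filter => k /=; rewrite eq_sym.
by rewrite big_seq1.
Qed.

Section PairChain.
Variables (R : realType) (X : multigraph).
Hypothesis Xlf : locally_finite X.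
Hypothesis deg2 : forall z : X, (2 <= deg z)%N.
Implicit Types (x y z u v : X) (e f g : oedge X) (s t r : X * X).

Definition outs y : seq (oedge X) := fset_set (out_edges y).
Definition betw u v : seq (oedge X) := fset_set (edges_between u v).
Definition nbrs y : seq X := undup (map (@tgt X) (outs y)).

Lemma fin_between u v : finite_set (edges_between u v).
Proof. by apply: sub_finite_set (Xlf u) => e []. Qed.

Lemma mem_outs y e : (e \in outs y) = (src e == y).
Proof.
by rewrite /outs in_fset_set//; apply/idP/eqP; rewrite inE.
Qed.

Lemma mem_betw u v e : (e \in betw u v) = (src e == u) && (tgt e == v).
Proof.
rewrite /betw in_fset_set; last exact: fin_between.
apply/idP/andP; rewrite inE; first by move=> [-> ->].
by move=> [/eqP ? /eqP ?].
Qed.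

Lemma outs_uniq y : uniq (outs y). Proof. exact: fset_uniq. Qed.
Lemma betw_uniq u v : uniq (betw u v). Proof. exact: fset_uniq. Qed.
Lemma nbrs_uniq y : uniq (nbrs y). Proof. exact: undup_uniq. Qed.

Lemma betw_filter u v : perm_eq (betw u v) [seq g <- outs u | tgt g == v].
Proof.
apply: uniq_perm; [exact: betw_uniq|exact/filter_uniq/outs_uniq|].
by move=> e; rewrite mem_betw mem_filter mem_outs andbC.
Qed.

Lemma nedges_gt0 u v : (0 < nedges u v)%N = has (fun e => tgt e == v) (outs u).
Proof.
rewrite /nedges -/(betw u v) (perm_size (betw_filter u v)) size_filter.
by rewrite has_count.
Qed.

Lemma mem_nbrs u v : (v \in nbrs u) = (0 < nedges u v)%N.
Proof.
rewrite nedges_gt0 mem_undup; apply/mapP/hasP => [[e eu ->]|[e eu /eqP <-]];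
by exists e.
Qed.

Lemma nedges_sym u v : nedges u v = nedges v u.
Proof.
rewrite /nedges -!/(betw _ _) -(size_map (@flip X)); apply: perm_size.
apply: uniq_perm; last 1 first.
- move=> e; apply/mapP/idP => [[f + ->]|].
    by rewrite !mem_betw src_flip tgt_flip andbC.
  by exists (flip e); rewrite ?flipK// mem_betw src_flip tgt_flip andbC -mem_betw.
- rewrite map_inj_uniq; [exact: betw_uniq|exact: can_inj (@flipK X)].
- exact: betw_uniq.
Qed.

Lemma deg_nbrs x : deg x = \sum_(z <- nbrs x) nedges x z.
Proof.
rewrite /deg -/(outs x) -sum1_size (big_fiber (h := @tgt X) _ (nbrs_uniq x)).
  apply: eq_bigr => z _; rewrite -big_filter -(perm_big _ (betw_filter x z))/=.
  by rewrite sum1_size.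
by move=> e ex; rewrite mem_undup map_f.
Qed.

Definition pnext s : seq (X * X) := [seq (s.2, z) | z <- nbrs s.2].
(** The number of edges to z that may follow a given edge from s.1 to s.2: the
    reversal of that edge is among the edges from s.2 to z iff z = s.1. *)
Definition pmult s z : nat := (nedges s.2 z - (z == s.1))%N.
Definition pkernel s t : R :=
  if t.1 == s.2 then (pmult s t.2)%:R / ((deg s.2)%:R - 1) else 0.

Lemma degB1_gt0 z : 0 < (deg z)%:R - 1 :> R.
Proof. by rewrite subr_gt0 ltr1n. Qed.

Lemma pkernel_ge0 s t : 0 <= pkernel s t.
Proof.
by rewrite /pkernel; case: ifP => // _; rewrite divr_ge0// ltW// degB1_gt0.
Qed.

Lemma big_outs (V : nmodType) y (P : oedge X -> V) :
  \sum_(g <- outs y) P g = \sum_(z <- nbrs y) \sum_(g <- betw y z) P g.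
Proof.
rewrite (big_fiber (h := @tgt X) _ (nbrs_uniq y)); last first.
  by move=> e ex; rewrite mem_undup map_f.
by apply: eq_bigr => z _; rewrite -big_filter -(perm_big _ (betw_filter y z)).
Qed.

Lemma big_in_edges (V : nmodType) y (P : oedge X -> V) :
  \sum_(f \in in_edges y) P f = \sum_(u <- nbrs y) \sum_(g <- betw u y) P g.
Proof.
have fy := finite_in_edges Xlf y.
rewrite fsbig_finite// (big_fiber (h := @src X) _ (nbrs_uniq y)); last first.
  move=> e; rewrite in_fset_set// inE => <-.
  rewrite mem_nbrs nedges_sym nedges_gt0; apply/hasP; exists e => //.
  by rewrite mem_outs.
apply: eq_bigr => u _; rewrite -big_filter; apply: perm_big.
apply: uniq_perm; [exact/filter_uniq/fset_uniq|exact: betw_uniq|].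
move=> e; rewrite mem_filter mem_betw in_fset_set//; congr (_ && _).
by apply/idP/eqP; rewrite inE.
Qed.

Lemma qEnS n e f :
  qEn R n.+1 e f = \sum_(g <- outs (tgt e)) qE R e g * qEn R n g f.
Proof.
rewrite /= -(fsbig_widen (out_edges (tgt e)))//=; first by rewrite fsbig_finite.
move=> g [_ /= ge]; rewrite /qE /nb_step ifF ?mul0r//.
by apply/negP => /andP[/eqP].
Qed.

Lemma sum_qE e z : \sum_(g <- betw (tgt e) z) qE R e g =
  pkernel (src e, tgt e) (tgt e, z).
Proof.
rewrite /pkernel eqxx/= /pmult/=.
under eq_big_seq => g.
  rewrite mem_betw => /andP[/eqP ge /eqP gz].
  rewrite /qE /nb_step ge eqxx/=; over.
rewrite -big_mkcond/= big_const_seq iter_addr_0 -[LHS]mulr_natl; congr (_%:R * _).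
have <- : count_mem (flip e) (betw (tgt e) z) = (z == src e) :> nat.
  by rewrite count_uniq_mem ?betw_uniq// mem_betw src_flip tgt_flip eqxx eq_sym.
by rewrite /nedges -/(betw _ _) -(count_predC (pred1 (flip e))) addKn.
Qed.

(** The transition weights from an edge e to the bunches of parallel edges
    depend only on the end points of e ([sum_qE]), and by induction so do
    those of the powers. *)
Lemma lumping n e u v : \sum_(f <- betw u v) qEn R n e f =
  kpow pnext pkernel n (src e, tgt e) (u, v).
Proof.
elim: n e => [|n IH] e.
  rewrite [RHS]/=; have [euv|neuv] := boolP (e \in betw u v).
    rewrite (bigD1_seq e)//= ?betw_uniq// eqxx big1 ?addr0; last first.
      by move=> f; rewrite eq_sym => /negPf ->.
    by move: euv; rewrite mem_betw xpair_eqE => ->.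
  rewrite big1_seq/=; last by move=> f fuv; case: eqP fuv neuv => // -> ->.
  by move: neuv; rewrite mem_betw xpair_eqE => /negPf ->.
under eq_bigr do rewrite qEnS.
rewrite exchange_big/=; under eq_bigr do rewrite -mulr_sumr IH.
rewrite big_outs big_map; apply: eq_bigr => z _.
rewrite -sum_qE mulr_suml; apply: eq_big_seq => g.
by rewrite mem_betw => /andP[/eqP -> /eqP ->].
Qed.

Lemma nbrw_pairs n x y : nbrw R n.+1 x y = (deg x)%:R^-1 *
  \sum_(z <- nbrs x) \sum_(u <- nbrs y)
    (nedges x z)%:R * kpow pnext pkernel n (x, z) (u, y).
Proof.
rewrite nbrw_succ//; congr (_ * _).
rewrite fsbig_finite//= -/(outs x) big_outs; apply: eq_bigr => z _.
rewrite -mulr_sumr mulr_natl /nedges -/(betw x z) -(count_predT (betw x z)).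
rewrite -iter_addr_0 -big_const_seq; apply: eq_big_seq => e; rewrite mem_betw => /andP[/eqP ex /eqP ez].
rewrite big_in_edges; apply: eq_bigr => u _.
by rewrite lumping ex ez.
Qed.

(** The reversal of the current edge removes exactly one of the edges leaving
    s.2. This uses that s carries an edge: otherwise truncated subtraction
    would remove none. *)
Lemma pkernel_row s : (0 < nedges s.1 s.2)%N ->
  \sum_(t <- pnext s) pkernel s t = 1.
Proof.
case: s => x y /= exy; rewrite /pnext big_map /pkernel/=.
under eq_bigr do rewrite eqxx.
rewrite -mulr_suml -natr_sum.
have -> : (\sum_(z <- nbrs y) pmult (x, y) z)%N = (deg y).-1.
  rewrite deg_nbrs; have xy : x \in nbrs y by rewrite mem_nbrs nedges_sym.
  rewrite (bigD1_seq x)//= ?nbrs_uniq// [in RHS](bigD1_seq x)//= ?nbrs_uniq//.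
  rewrite {1}/pmult/= eqxx subn1 (eq_bigr (fun z => nedges y z)); last first.
    by move=> z /negPf zx; rewrite /pmult/= zx subn0.
  by move: exy; rewrite nedges_sym; case: (nedges y x).
by rewrite -subn1 natrB ?divff// ?gt_eqF ?degB1_gt0// ltnW.
Qed.

Lemma pkernel_valid s t : (0 < nedges s.1 s.2)%N -> 0 < pkernel s t ->
  (0 < nedges t.1 t.2)%N.
Proof.
move=> _; rewrite /pkernel; case: eqP => [ts|_]; last by rewrite ltxx.
rewrite /pmult ts; case: (nedges s.2 t.2) => //.
by rewrite sub0n mul0r ltxx.
Qed.

Lemma kpow_pkernel_le1 n s t : (0 < nedges s.1 s.2)%N ->
  kpow pnext pkernel n s t <= 1.
Proof.
elim: n s => [|n IH] s es /=; first by rewrite lern1 leq_b1.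
rewrite -(pkernel_row es); apply: ler_sum => r _.
have := pkernel_ge0 s r; rewrite le_eqVlt => /orP[/eqP <-|sr].
  by rewrite mul0r.
by rewrite -[X in _ <= X]mulr1 ler_pM2l//; apply/IH/(pkernel_valid es).
Qed.

Lemma automorphism_nbrs (h : X -> X) x : automorphism h ->
  perm_eq (nbrs (h x)) (map h (nbrs x)).
Proof.
move=> [[h' hK h'K] hE]; apply: uniq_perm; first exact: nbrs_uniq.
  by rewrite map_inj_uniq ?nbrs_uniq//; exact: can_inj hK.
move=> z; rewrite -(h'K z) mem_nbrs hE mem_map; last exact: can_inj hK.
by rewrite mem_nbrs.
Qed.

Lemma automorphism_deg (h : X -> X) x : automorphism h -> deg (h x) = deg x.
Proof.
move=> ah; rewrite deg_nbrs (perm_big _ (automorphism_nbrs x ah)) big_map/=.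
by rewrite [RHS]deg_nbrs; apply: eq_bigr => z _; case: ah.
Qed.

Definition map_pair (h : X -> X) s := (h s.1, h s.2).

Lemma automorphism_kpow (h : X -> X) n s t : automorphism h ->
  kpow pnext pkernel n (map_pair h s) (map_pair h t) = kpow pnext pkernel n s t.
Proof.
move=> ah; have [[h' hK h'K] hE] := ah; have hI := can_inj hK.
elim: n s => [|n IH] s /=.
  by rewrite !xpair_eqE -!pair_eqE /pair_eq/= !(inj_eq hI).
rewrite !big_map/= (perm_big _ (automorphism_nbrs s.2 ah))/= big_map.
apply: eq_bigr => z _; rewrite -[X in kpow _ _ _ X]/(map_pair h (s.2, z)) IH.
congr (_ * _); rewrite /pkernel/= !eqxx (automorphism_deg _ ah).
by rewrite /pmult/= hE (inj_eq hI).
Qed.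

End PairChain.

(** * Irreducibility *)

Section Walks.
Variables (X : multigraph).
Hypothesis Xlf : locally_finite X.
Hypothesis deg2 : forall z : X, (2 <= deg z)%N.
Implicit Types (x y z u v : X) (p s t r : X * X).

Definition valid s : bool := (0 < nedges s.1 s.2)%N.
Definition opp s : X * X := (s.2, s.1).
(** Possible transitions: if there are several edges between s.1 and s.2, a
    step from s to its opposite is possible, along another of these edges. *)
Definition step s t : bool :=
  (t.1 == s.2) && ((t.2 == s.1) < nedges t.1 t.2)%N.

Lemma oppK : involutive opp. Proof. by case. Qed.

Lemma valid_opp s : valid (opp s) = valid s.
Proof. by rewrite /valid /= nedges_sym. Qed.

Lemma step_valid s t : step s t -> valid t.
Proof. by move=> /andP[_]; exact: leq_ltn_trans. Qed.

Lemma step_src s t : step s t -> t.1 = s.2.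
Proof. by move=> /andP[/eqP]. Qed.

Lemma step_opp s t : valid s -> step s t -> step (opp t) (opp s).
Proof.
case: s t => x y [y' z] vs /andP[/= /eqP -> h]; rewrite /step/= eqxx/=.
have [xz|] := eqVneq x z; first by move: h; rewrite -xz eqxx nedges_sym.
by move: vs; rewrite /valid nedges_sym.
Qed.

Lemma step_flip s : step s (opp s) = step (opp s) s.
Proof. by rewrite /step /= !eqxx nedges_sym. Qed.

Lemma step_other s t : valid t -> t.1 = s.2 -> t <> opp s -> step s t.
Proof.
case: s t => x y [y' z] vt /= ty; rewrite ty in vt * => ts.
rewrite /step/= eqxx/=; case: eqP => [zx|//].
by case: ts; rewrite zx.
Qed.

(** If the reversal of the current edge were the only edge leaving s.2, the
    degree of s.2 would be 1. *)
Lemma step_exists s : valid s -> exists t, step s t.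
Proof.
case: s => x y vs; apply: contrapT => /forallNP nst.
have := deg2 y; rewrite ltnNge => /negP; apply.
rewrite deg_nbrs//; apply: (@leq_trans (\sum_(z <- nbrs y) (z == x))).
  apply: leq_sum => z _; rewrite leqNgt; apply/negP => h.
  by apply: (nst (y, z)); rewrite /step/= eqxx.
rewrite (eq_bigr (fun z => if z == x then 1 else 0)%N); last first.
  by move=> z _; case: eqP.
by rewrite -big_mkcond sum1_count count_uniq_mem ?nbrs_uniq// leq_b1.
Qed.

Fixpoint walk n s t : Prop :=
  if n is m.+1 then exists r, step s r /\ walk m r t else s = t.

Lemma walk_cat n m s r t : walk n s r -> walk m r t -> walk (n + m) s t.
Proof.
elim: n s => [s -> //|n IH] s [u [su ur]] rt.
by exists u; split => //; exact: IH ur rt.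
Qed.

Lemma walk1 s t : step s t -> walk 1 s t.
Proof. by exists t. Qed.

Lemma walk_rcons n s r t : walk n s r -> step r t -> walk n.+1 s t.
Proof. by move=> sr rt; rewrite -addn1; exact: walk_cat sr (walk1 rt). Qed.

Lemma walk_last n s t : walk n.+1 s t -> exists r, walk n s r /\ step r t.
Proof.
elim: n s => [|n IH] s; first by move=> [r [sr <-]]; exists s.
move=> [r [sr /IH[u [ru ut]]]]; exists u; split => //.
by exists r.
Qed.

Lemma walk_valid n s t : valid s -> walk n s t -> valid t.
Proof.
elim: n s => [s vs <-//|n IH] s vs [r [/step_valid vr rt]]; exact: IH rt.
Qed.

Lemma walk_opp n s t : valid s -> walk n s t -> walk n (opp t) (opp s).
Proof.
elim: n s => [s _ ->//|n IH] s vs [r [sr rt]].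
apply: (walk_rcons (IH r (step_valid sr) rt)); exact: step_opp.
Qed.

Lemma walk_fun n s t : walk n s t -> exists f : nat -> X * X,
  [/\ f 0%N = s, f n = t & forall i, (i < n)%N -> step (f i) (f i.+1)].
Proof.
elim: n s => [s ->|n IH s]; first by exists (fun=> t).
move=> [r [sr /IH[f [f0 fn fstep]]]].
exists (fun i => if i is j.+1 then f j else s); split => //.
by case=> [|i] /= i_n; [rewrite f0|exact: fstep].
Qed.

Lemma fun_walk (f : nat -> X * X) n d i :
  (forall j, (j < n)%N -> step (f j) (f j.+1)) -> (i + d <= n)%N ->
  walk d (f i) (f (i + d)%N).
Proof.
move=> fs; elim: d i => [|d IH] i idn; first by rewrite /= addn0.
exists (f i.+1); split; first by apply: fs; lia.
by rewrite addnS -addSn; apply: IH; lia.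
Qed.

Lemma fun_walk0 (f : nat -> X * X) n i :
  (forall j, (j < n)%N -> step (f j) (f j.+1)) -> (i <= n)%N ->
  walk i (f 0%N) (f i).
Proof. exact: (@fun_walk f n i 0). Qed.

Definition reach s t := exists n, walk n s t.

Lemma reach_refl s : reach s s. Proof. by exists 0%N. Qed.
Lemma reach_trans s r t : reach s r -> reach r t -> reach s t.
Proof. by move=> [n sr] [m rt]; exists (n + m)%N; exact: walk_cat sr rt. Qed.
Lemma reach_step s t : step s t -> reach s t.
Proof. by move=> st; exists 1%N; exact: walk1. Qed.
Lemma reach_opp s t : valid s -> reach s t -> reach (opp t) (opp s).
Proof. by move=> vs [n st]; exists n; exact: walk_opp. Qed.
Lemma reach_valid s t : valid s -> reach s t -> valid t.
Proof. by move=> vs [n]; exact: walk_valid. Qed.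

(** The walk visits k + 1 pairs, so it has k + 1 edges; the last edge may be
    the reversal of the first one. *)
Definition closed_walk k v :=
  exists s t, [/\ valid s, s.1 = v, t.2 = v & walk k s t].

(** Walks between vertices, with n edges; n = 0 is included for the descent in
    [closed_walk_of_two_lengths]. *)
Definition vwalk n x y := if n is m.+1 then
  exists s t, [/\ valid s, s.1 = x, t.2 = y & walk m s t] else x = y.

Lemma vwalk_pred n s t : valid s -> walk n s t -> vwalk n s.1 t.1.
Proof.
case: n => [_ ->//|n vs /walk_last[r [sr rt]]].
by exists s, r; split => //; rewrite (step_src rt).
Qed.

Lemma step_or_eq s t : valid t -> s.2 = t.2 -> step s (opp t) \/ s = t.
Proof.
move=> vt st; have [->|/eqP nst] := eqVneq s t; first by right.
left; apply: step_other => //; first by rewrite valid_opp.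
by move/(can_inj oppK) => ts; apply: nst.
Qed.

(** Concatenate the first walk with the reversal of the second. This is
    non-backtracking unless both walks end with the same edge, and that edge
    can then be removed from both; the lengths being different, this stops at
    a closed walk at the latest when one of the walks is exhausted. *)
Lemma closed_walk_of_two_lengths n m x y : vwalk n x y -> vwalk m x y -> n != m ->
  exists k, closed_walk k x.
Proof.
elim: n m y => [|n IH] [|m] y //.
- by move=> <- [s [t [vs sx tx st]]] _; exists m, s, t.
- move=> [s [t [vs sx tx st]]] xy _; exists n, s, t.
  by split => //; rewrite tx.
move=> [s [t [vs sx ty st]]] [s' [t' [vs' sx' ty' st']]] nm.
have vt' := walk_valid vs' st'.
have [tt'|tt'] := @step_or_eq t t' vt' (etrans ty (esym ty')).
  exists (n + m.+1)%N, s, (opp s'); split => //.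
  by apply: walk_cat st _; exists (opp t'); split => //; exact: walk_opp.
have := vwalk_pred vs st; have := vwalk_pred vs' st'.
by rewrite sx sx' -tt' => h1 h2; apply: (IH m t.1).
Qed.

(** With p = (u, v), conjugate the closed walk at v by p. Wherever this
    backtracks, the closed walk begins with the opposite of p or ends with p,
    and the backtracking pair cancels. *)
Lemma closed_walk_neighbour k u v : closed_walk k v -> (0 < nedges u v)%N ->
  exists k', closed_walk k' u.
Proof.
have [<- cu _|uv] := eqVneq u v; first by exists k.
move=> [s [t [vs sv tv st]]] e_uv; pose p := (u, v).
have vp : valid p by [].
have vt := walk_valid vs st.
have tp : step t (opp p) \/ t = p by exact: step_or_eq.
have ps : step p s \/ s = opp p.
  have [->|/eqP ns] := eqVneq s (opp p); first by right.
  by left; apply: step_other.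
have step_ps : ~~ step p s -> s = opp p by case: ps => // ->.
have [{ps} ps|nps] := boolP (step p s).
  case: tp => [tp|tp].
    exists k.+2, p, (opp p); split => //.
    by exists s; split => //; exact: walk_rcons st tp.
  case: k st => [st|k /walk_last[r [sr rt]]].
    by case/eqP: uv; rewrite -sv st tp.
  exists k.+1, p, r; split => //; first by rewrite -(step_src rt) tp.
  by exists s.
have {}ps := step_ps nps.
case: k st => [st|k [r [sr rt]]].
  by case/eqP: uv; rewrite -tv -st ps.
have ru : r.1 = u by rewrite (step_src sr) ps.
case: tp => [tp|tp].
  exists k.+1, r, (opp p); split => //; first exact: step_valid sr.
  exact: walk_rcons rt tp.
case: k rt => [rt|k /walk_last[r' [rr' rt]]].
  by case/negP: nps; rewrite ps step_flip; move: sr; rewrite ps rt tp.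
exists k, r, r'; split => //; first exact: step_valid sr.
by rewrite -(step_src rt) tp.
Qed.


Lemma closed_walk_everywhere k v : connected_graph X -> closed_walk k v ->
  forall u, exists k', closed_walk k' u.
Proof.
move=> Xc cv u.
elim: {u v cv}(Xc u v) (ex_intro (closed_walk^~ v) k cv) => [u v [e [eu ev]] [k' cv]|//|].
  apply: closed_walk_neighbour cv _; rewrite nedges_gt0//; apply/hasP; exists e.
    by rewrite mem_outs// eu.
  by rewrite ev.
by move=> u v z _ IH1 _ IH2 /IH2 /IH1.
Qed.

Lemma automorphism_walk (h : X -> X) n s t : automorphism h ->
  walk n s t -> walk n (map_pair h s) (map_pair h t).
Proof.
move=> [[h' hK _] hE]; elim: n s => [s ->//|n IH] s [r [sr /IH rt]].
exists (map_pair h r); split => //; move: sr; rewrite /step/= hE.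
by rewrite !(inj_eq (can_inj hK)).
Qed.

Lemma automorphism_closed_walk (h : X -> X) k v : automorphism h ->
  closed_walk k v -> closed_walk k (h v).
Proof.
move=> ah [s [t [vs sv tv st]]]; exists (map_pair h s), (map_pair h t); split.
- by rewrite /valid /=; case: ah => _ ->.
- by rewrite /= sv.
- by rewrite /= tv.
- exact: automorphism_walk.
Qed.

Lemma closed_walk_bounded : almost_transitive X ->
  (forall v, exists k, closed_walk k v) ->
  exists m, forall v, exists2 k, (k <= m)%N & closed_walk k v.
Proof.
move=> atX cw.
have /choice[kappa kP] : forall O : set X, exists k, forall v,
    aut_orbit v = O -> closed_walk k v.
  move=> O; have [[v <-]|nO] := pselect (exists v, aut_orbit v = O); last first.
    by exists 0%N => v vO; case: nO; exists v.
  have [k kv] := cw v; exists k => u uv.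
  have : aut_orbit u u by exists id => //; split => //; exists id.
  by rewrite uv => -[h ah ->]; exact: automorphism_closed_walk.
pose r : seq (set X) := fset_set (range (@aut_orbit X)).
exists (\max_(O <- r) kappa O)%N => v; exists (kappa (aut_orbit v)); last exact: kP.
by apply: leq_bigmax_seq => //; rewrite in_fset_set// inE; exists v.
Qed.

Lemma walk_finite n s : finite_set [set t | walk n s t].
Proof.
elim: n s => [|n IH] s.
  by apply: sub_finite_set (finite_set1 s) => t /= ->.
apply: (@sub_finite_set _ _ (\bigcup_(r in [set` pnext s]) [set t | walk n r t])).
  move=> t [r [sr rt]]; exists r => //=; case: r sr {rt} => a b /andP[/= /eqP -> h].
  by apply: map_f; rewrite mem_nbrs//; apply: leq_ltn_trans h.
by apply: bigcup_finite => // r _; exact: IH.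
Qed.

(** ** The states reachable from a pair that cannot be reversed *)

Section NoTurn.
Variable e : X * X.
Hypothesis ve : valid e.
Hypothesis noturn : ~ reach e (opp e).

Lemma cone_opp f : reach e f -> ~ reach e (opp f).
Proof.
move=> ef /(reach_opp ve); rewrite oppK => fe.
by apply: noturn; exact: reach_trans ef fe.
Qed.

Lemma cone_step f g : reach e f -> step f g -> reach e g.
Proof. by move=> ef /reach_step; exact: reach_trans. Qed.

(** If two different edges f and g of the cone had the same target, the walk
    could go on from f with the opposite of g. *)
Lemma cone_enter f g : reach e f -> reach e g -> f.2 = g.2 -> f = g.
Proof.
move=> ef eg fg.
have [fg'|//] := step_or_eq (reach_valid ve eg) fg.
by have := cone_opp eg (cone_step ef fg').
Qed.

Lemma cone_backtrack (p q : nat -> X * X) n m :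
    (forall i, (i < n)%N -> step (p i) (p i.+1)) ->
    (forall i, (i < m)%N -> step (q i) (q i.+1)) ->
    (forall i, (i <= n)%N -> reach e (p i)) ->
    (forall i, (i <= m)%N -> reach e (q i)) -> p n = q m ->
  forall i, (i <= n)%N -> (i <= m)%N -> p (n - i)%N = q (m - i)%N.
Proof.
move=> ps qs ep eq pq; elim=> [|i IH] i_n im; first by rewrite !subn0.
have {}IH := IH (ltnW i_n) (ltnW im).
apply: cone_enter; [by apply: ep; lia|by apply: eq; lia|].
rewrite -(@step_src _ (p (n - i)%N)) ?IH ?(@step_src (q (m - i.+1)%N))//.
  by have := qs (m - i.+1)%N; rewrite subnSK//; apply; lia.
by have := ps (n - i.+1)%N; rewrite subnSK// IH; apply; lia.
Qed.

(** A ray in a finite cone repeats itself, and by unique entering edges it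
    comes back to e itself. Then every vertex entered by the cone has all its
    neighbours entered by the cone too, so the finite cone covers the infinite
    connected graph. *)
Lemma cone_infinite : infinite_set [set: X] -> connected_graph X ->
  infinite_set [set f | reach e f].
Proof.
move=> Xinf Xc finR; apply: Xinf.
have /choice[succ succP] : forall s, exists t, valid s -> step s t.
  move=> s; have [vs|] := boolP (valid s); last by exists s.
  by have [t st] := step_exists vs; exists t.
pose ray n := iter n succ e.
have eray n : reach e (ray n).
  elim: n => [|n IH]; first exact: reach_refl.
  by apply: (cone_step IH); apply: succP; exact: (reach_valid ve IH).
have sray n : step (ray n) (ray n.+1).
  by apply: succP; exact: (reach_valid ve (eray n)).
have [d [d0 ed]] : exists d, (0 < d)%N /\ ray d = e.
  have shift d i : ray i = ray (i + d)%N -> e = ray d.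
    elim: i => [|i IH] //; rewrite addSn => ii; apply: IH; apply: cone_enter => //.
    by rewrite -(step_src (sray i)) ii (step_src (sray _)).
  apply: contrapT => nd; apply: infinite_nat.
  have rayI : injective ray.
    move=> i j; wlog ij : i j / (i <= j)%N => [wl rij|rij].
      by case/orP: (leq_total i j) => ij; [exact: wl|exact/esym/wl].
    apply/eqP; rewrite eqn_leq ij leqNgt; apply/negP => lt_ij; apply: nd.
    exists (j - i)%N; split; first by rewrite subn_gt0.
    by rewrite -(@shift (j - i)%N i)// subnKC.
  have := @finite_preimage _ _ [set f | reach e f] ray (in2W rayI) finR.
  by apply: sub_finite_set => n _; exact: eray.
have closedV u v : (exists2 f, reach e f & f.2 = v) -> (0 < nedges v u)%N ->
    exists2 f, reach e f & f.2 = u.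
  move=> [f ef fv] vu; have vvu : valid (v, u) by [].
  have [uf|uf] := eqVneq u f.1; last first.
    exists (v, u) => //; apply: cone_step ef _; apply: step_other => //.
    by move=> [_ /eqP]; apply/negP.
  have [n] := ef; case: n => [ef'|n /walk_last[r [er rf]]].
    by exists (ray d.-1) => //; rewrite uf -ef' -(step_src (sray _)) prednK// ed.
  by exists r; [exists n|rewrite uf (step_src rf)].
have allV u : exists2 f, reach e f & f.2 = u.
  have := ex_intro2 _ (fun f => f.2 = e.2) e (reach_refl e) erefl.
  elim: {u}(Xc e.2 u) => [u v [g [gu gv]]|//|u v z _ IH1 _ IH2 /IH1/IH2//] /closedV.
  apply; rewrite nedges_gt0//; apply/hasP; exists g; last by rewrite gv.
  by rewrite mem_outs// gu.
apply: (sub_finite_set _ (finite_image snd finR)) => u _.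
by have [f ef <-] := allV u; exists f.
Qed.

(** Only finitely many states are within m steps of e, so the infinite cone has
    one farther away; a shortest walk to it has no repetition. *)
Lemma cone_geodesic : infinite_set [set: X] -> connected_graph X ->
  forall m, exists n (p : nat -> X * X), [/\ (m < n)%N, p 0%N = e,
    forall i, (i < n)%N -> step (p i) (p i.+1) &
    forall i j, (i < j <= n)%N -> p i <> p j].
Proof.
move=> Xinf Xc m.
have [f [n0 en0] mf] : exists2 f, reach e f &
    forall i, (i <= m)%N -> ~ walk i e f.
  apply: contrapT => nf; apply: (cone_infinite Xinf Xc).
  apply: (@sub_finite_set _ _ (\bigcup_(i in `I_m.+1) [set f | walk i e f])).
    move=> f ef /=; apply: contrapT => nef; apply: nf; exists f => // i im eif.
    by apply: nef; exists i.
  by apply: bigcup_finite => // i _; exact: walk_finite.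
have [n /asboolP en nmin] := ex_minnP (P := fun n => `[< walk n e f >])
  (ex_intro _ n0 (asboolT en0)).
have [p [p0 pn ps]] := walk_fun en.
exists n, p; split => //; first by rewrite ltnNge; apply/negP => /mf.
move=> i j /andP[ij jn] pij.
have w1 : walk i e (p i) by rewrite -p0; apply: (fun_walk0 ps); lia.
have w2 : walk (n - j) (p j) f.
  by rewrite -pn -{2}(subnKC jn); apply: (fun_walk ps); lia.
rewrite -pij in w2.
by have /asboolP/nmin := walk_cat w1 w2; lia.
Qed.

(** A closed walk shorter than p, at the end vertex of p, can follow p
    backwards, but not all the time, because the targets of the p i are
    distinct. When it leaves p it enters the cone, never leaves it again, and
    ends with the last edge of p; by unique entering edges its final part then
    runs along p, starting where it left p. So it left p by the edge just
    traversed backwards, which in the cone is not possible. *)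
Lemma noturn_unbounded_closed_walks m : infinite_set [set: X] -> connected_graph X ->
  ~ (forall v, exists2 k, (k <= m)%N & closed_walk k v).
Proof.
move=> Xinf Xc cw.
have [n [p [mn p0 ps pI]]] := cone_geodesic Xinf Xc m.+1.
have ep i : (i <= n)%N -> reach e (p i).
  by move=> i_n; exists i; rewrite -p0; exact: (fun_walk0 ps).
have vp i : (i <= n)%N -> valid (p i) by move=> /ep; exact: reach_valid.
have pinj i j : (i <= n)%N -> (j <= n)%N -> p i = p j -> i = j.
  move=> i_n jn pij; have [ij|ji|//] := ltngtP i j.
    by case: (@pI i j); rewrite ?ij.
  by case: (@pI j i); rewrite ?ji.
have [k km [s [t [vs sv tv /walk_fun[g [g0 gk gs]]]]]] := cw (p n).2.
have vg i : (i <= k)%N -> valid (g i).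
  move=> ik; apply: (@walk_valid i s _ vs).
  by rewrite -g0; exact: (fun_walk0 gs).
have back j : (j <= k)%N -> g j = opp (p (n - j)%N).
  elim/ltn_ind: j => j IH jk; apply: contrapT => gj.
  have srcj : (g j).1 = (p (n - j)%N).2.
    case: j IH jk gj => [|j] IH jk gj; first by rewrite subn0 g0.
    rewrite (step_src (gs j jk)) IH//=; last lia.
    have := step_src (ps (n - j.+1)%N _); rewrite subnSK; last lia.
    by move=> -> //; lia.
  have egj : reach e (g j).
    apply: cone_step (ep (n - j)%N _) _; first lia.
    by apply: step_other => //; exact: vg.
  pose q i := g (j + i)%N.
  have qs i : (i < k - j)%N -> step (q i) (q i.+1).
    by move=> ikj; rewrite /q addnS; apply: gs; lia.
  have eq i : (i <= k - j)%N -> reach e (q i).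
    elim: i => [|i IHi] ikj; first by rewrite /q addn0.
    by apply: cone_step (IHi (ltnW ikj)) _; exact: qs.
  have pq : p n = q (k - j)%N.
    apply: cone_enter; [exact: ep|exact: eq|].
    by rewrite /q subnKC// gk tv.
  have gjp : p (n - (k - j))%N = g j.
    rewrite (cone_backtrack ps qs ep eq pq) ?subnn /q ?addn0//; lia.
  have jkE : (n - (k - j)).-1 = (n - j)%N.
    apply: pinj; [lia|lia|]; apply: cone_enter; [by apply: ep; lia..|].
    rewrite -srcj -gjp -(@step_src _ (p (n - (k - j))%N))//.
    have := ps (n - (k - j)).-1; rewrite prednK; last lia.
    by apply; lia.
  (* So k + 1 = 2 j: the walk follows j edges of p back, then turns around. *)
  have j0 : (0 < j)%N by lia.
  have gj1 : g j.-1 = opp (g j).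
    rewrite IH; [|lia|lia]; congr opp; rewrite -gjp; congr p; lia.
  have := gs j.-1; rewrite prednK// gj1 => /(_ jk) sgj.
  by case: (@cone_opp (g j)) => //; apply: cone_step egj _; rewrite step_flip.
have := tv; rewrite -gk back//= => pk.
have := pinj (n - k).-1 n; rewrite leqnn => /(_ _ isT); move=> nk.
have : (n - k).-1 = n.
  apply: nk; first lia.
  apply: cone_enter; [by apply: ep; lia|exact: ep|].
  rewrite -pk -(@step_src _ (p (n - k)%N))//.
  have := ps (n - k).-1; rewrite prednK; last lia.
  by apply; lia.
lia.
Qed.

End NoTurn.


(** Once every pair can be reversed, any two edges leaving the same vertex
    reach each other: reverse the first, then take the second. *)
Lemma reach_all : infinite_set [set: X] -> connected_graph X ->
    almost_transitive X -> (exists k v, closed_walk k v) ->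
  forall s t, valid s -> valid t -> reach s t.
Proof.
move=> Xinf Xc atX [k [w0 cv]].
have [m cm] := closed_walk_bounded atX (closed_walk_everywhere Xc cv).
have turn s : valid s -> reach s (opp s).
  move=> vs; apply: contrapT => nt; exact: (noturn_unbounded_closed_walks vs nt Xinf Xc cm).
have fork s t : valid s -> valid t -> s.1 = t.1 -> reach s t.
  move=> vs vt st; have [->|/eqP nst] := eqVneq s t; first exact: reach_refl.
  apply: reach_trans (turn s vs) _; apply: reach_step; apply: step_other => //.
  by rewrite oppK => ts; apply: nst.
suff H a b : Relation_Operators.clos_refl_trans X
    (fun u v => exists e, src e = u /\ tgt e = v) a b ->
    forall s t, valid s -> valid t -> s.1 = a -> t.1 = b -> reach s t.
  by move=> s t vs vt; exact: (H s.1 t.1 (Xc _ _)).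
elim=> {a b} [u v [e [eu ev]] s t vs vt su tv|u s t vs vt su tu|].
- have vp : valid (u, v).
    rewrite /valid/= nedges_gt0//; apply/hasP; exists e; last by rewrite ev.
    by rewrite mem_outs// eu.
  apply: (reach_trans (fork s (u, v) vs vp su)).
  apply: (reach_trans (turn _ vp)); apply: fork => //.
  by rewrite valid_opp.
- by apply: fork => //; rewrite su tu.
move=> u v z _ IH1 _ IH2 s t vs vt su tz.
have [w vw] : exists w, valid (v, w).
  have : (0 < deg v)%N by exact: leq_trans (deg2 v).
  rewrite deg_nbrs// lt0n sum_nat_seq_neq0 => /hasP[w _ /= vw].
  by exists w; rewrite /valid lt0n.
by apply: (reach_trans (IH1 s (v, w) vs vw su erefl)); exact: IH2.
Qed.

End Walks.

(** * The exponential rate *)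

Section Rho.
Variables (R : realType) (X : multigraph).
Hypothesis Xlf : locally_finite X.
Hypothesis deg2 : forall z : X, (2 <= deg z)%N.
Implicit Types (x y z u v : X) (s t r : X * X).
Local Notation P := (kpow (@pnext X) (@pkernel R X)).

Lemma pkernel_gt0 s t : (0 < pkernel R s t) = step s t.
Proof.
rewrite /pkernel /step; case: eqP => [ts|_] /=; last exact: ltxx.
by rewrite pmulr_lgt0 ?invr_gt0 ?degB1_gt0// ltr0n /pmult ts subn_gt0.
Qed.

Lemma kpow_gt0_walk n s t : 0 < P n s t <-> walk n s t.
Proof.
elim: n s => [|n IH] s /=.
  by rewrite ltr0n lt0b; split => [/eqP|->].
split=> [Pn|[r [sr rt]]].
  apply: contrapT => nw; move: Pn; rewrite big1 ?ltxx// => r _.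
  have := pkernel_ge0 R deg2 s r; rewrite le_eqVlt => /orP[/eqP <-|].
    by rewrite mul0r.
  rewrite pkernel_gt0 => sr.
  have := kpow_ge0 (@pnext X) (pkernel_ge0 R deg2) n r t.
  rewrite le_eqVlt => /orP[/eqP <-|]; first by rewrite mulr0.
  by move/IH => rt; case: nw; exists r.
have rs : r \in pnext s.
  case: r sr {rt} => a b /andP[/= /eqP -> h].
  by apply: map_f; rewrite mem_nbrs//; apply: leq_ltn_trans h.
rewrite (perm_big _ (perm_to_rem rs)) big_cons/=.
apply: ltr_pwDl; first by rewrite mulr_gt0 ?pkernel_gt0//; exact/IH.
apply: sumr_ge0 => i _; apply: mulr_ge0; first exact: pkernel_ge0.
exact: kpow_ge0 (pkernel_ge0 R deg2) _ _ _.
Qed.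

(** Boundedness makes [limn_sup] a genuine limit superior; for a sequence that
    is unbounded above it would be meaningless. *)
Lemma nbrw_bounded x y : exists2 C : R, 1 <= C & forall n, nbrw R n.+1 x y <= C.
Proof.
pose C : R := (deg x)%:R^-1 *
  \sum_(z <- nbrs x) \sum_(u <- nbrs y) (nedges x z)%:R.
have C0 : 0 <= C.
  by rewrite mulr_ge0 ?invr_ge0// sumr_ge0// => z _; rewrite sumr_ge0.
exists (1 + C) => [|n]; first by rewrite lerDl.
apply: (@le_trans _ _ C); last by rewrite lerDr.
rewrite nbrw_pairs//; apply: ler_wpM2l; first by rewrite invr_ge0.
rewrite big_seq [X in _ <= X]big_seq; apply: ler_sum => z xz.
apply: ler_sum => u _; rewrite -[X in _ <= X]mulr1; apply: ler_wpM2l => //.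
by apply: kpow_pkernel_le1 => //; rewrite -mem_nbrs.
Qed.

Lemma nbrw_ge0 n x y : 0 <= nbrw R n.+1 x y.
Proof.
rewrite nbrw_pairs// mulr_ge0 ?invr_ge0// sumr_ge0// => z _.
rewrite sumr_ge0// => u _; rewrite mulr_ge0//.
exact: kpow_ge0 (pkernel_ge0 R deg2) _ _ _.
Qed.

Lemma nbrw_root_bounded x y :
  bounded_fun (fun n : nat => nbrw R n x y `^ (n%:R^-1) : R^o).
Proof.
have [C C1 nC] := nbrw_bounded x y.
exists C; split; first by rewrite num_real.
move=> M CM n _ /=; rewrite ger0_norm ?powR_ge0//; apply/ltW/(le_lt_trans _ CM).
case: n => [|n]; first by rewrite invr0 powRr0.
apply: (@le_trans _ _ (C `^ (n.+1%:R^-1))).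
  apply: ge0_ler_powR => //; rewrite ?nnegrE ?nbrw_ge0//.
  by rewrite (le_trans ler01).
rewrite -[X in _ <= X]powRr1 ?(le_trans ler01)//; apply: ler_powR => //.
by rewrite invf_le1// ler1n.
Qed.

Lemma rhoQ_ge0 x y : 0 <= rhoQ R x y.
Proof.
have bu := nbrw_root_bounded x y.
rewrite /rhoQ limn_supE//; apply: lb_le_inf; first by eexists; exists 0%N.
move=> _ [n _ <-]; apply: le_trans (powR_ge0 (nbrw R n x y) n%:R^-1) _.
apply: ub_le_sup; last by exists n => /=.
exact/has_ubound_sdrop/bounded_fun_has_ubound.
Qed.

Lemma rhoQ_gt0_frequently x y : 0 < rhoQ R x y ->
  forall m, exists2 n, (m <= n)%N & 0 < nbrw R n.+1 x y.
Proof.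
move=> rho0 m; apply: contrapT => /forall2NP nP.
suff u0 : (fun n : nat => nbrw R n x y `^ (n%:R^-1) : R^o) @ \oo --> (0 : R^o).
  by move: rho0; rewrite /rhoQ (cvg_limn_inf_sup u0).2 ltxx.
apply: (@cvg_near_cst _ R^o); exists m.+1 => // -[//|n] /= mn.
have [|/negP] := nP n; first by rewrite ltnS in mn.
rewrite -leNgt => n0; apply/eqP.
have -> : nbrw R n.+1 x y = 0 by apply/eqP; rewrite eq_le n0 nbrw_ge0.
by rewrite powR0// invr_neq0.
Qed.

Lemma rhoQ_lt_eventually x y (th : R) : rhoQ R x y < th ->
  \forall n \near \oo, nbrw R n x y <= th ^+ n.
Proof.
set u := (fun n : nat => nbrw R n x y `^ (n%:R^-1) : R^o).
have bu : bounded_fun u := nbrw_root_bounded x y.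
rewrite /rhoQ -/u limn_supE// => rth.
have hu := bounded_fun_has_ubound bu.
have cs := cvg_sups_inf hu (bounded_fun_has_lbound bu).
have h : \forall n \near \oo, sups u n < th := cvgr_lt _ cs _ rth.
near=> n.
have sn : sups u n < th by near: n; exact: h.
have n0 : (0 < n)%N by near: n; exists 1%N.
have un : u n <= sups u n.
  by apply: ub_le_sup; [exact: has_ubound_sdrop|exists n => /=].
have -> : nbrw R n x y = u n ^+ n.
  rewrite -powR_mulrn ?powR_ge0// /u -powRrM mulVf ?powRr1 ?pnatr_eq0 -?lt0n//.
  by rewrite -(prednK n0) nbrw_ge0.
have uth := ltW (le_lt_trans un sn).
apply: lerXn2r; rewrite ?nnegrE ?powR_ge0//.
by apply: le_trans uth; exact: powR_ge0.
Unshelve. all: by end_near. Qed.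

Lemma nbrw_gt0_vwalk n x y : 0 < nbrw R n.+1 x y -> vwalk n.+1 x y.
Proof.
rewrite nbrw_pairs// => Pn; apply: contrapT => nv; move: Pn.
rewrite big1_seq ?mulr0 ?ltxx// => z /= xz; rewrite big1_seq// => u /= _.
have := kpow_ge0 (@pnext X) (pkernel_ge0 R deg2) n (x, z) (u, y).
rewrite le_eqVlt => /orP[/eqP <-|/kpow_gt0_walk w]; first by rewrite mulr0.
by case: nv; exists (x, z), (u, y); split => //; rewrite /valid -mem_nbrs.
Qed.

Lemma kpow_le_nbrw x y z u : z \in nbrs x -> u \in nbrs y ->
  exists2 c : R, 0 < c & forall n, c * P n (x, z) (u, y) <= nbrw R n.+1 x y.
Proof.
move=> xz yu; exists (deg x)%:R^-1.
  by rewrite invr_gt0 ltr0n; exact: leq_trans (deg2 x).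
move=> n; rewrite nbrw_pairs//; apply: ler_wpM2l; first by rewrite invr_ge0.
have K0 s t : 0 <= P n s t by exact: kpow_ge0 (pkernel_ge0 R deg2) _ _ _.
rewrite (perm_big _ (perm_to_rem xz)) big_cons/=.
rewrite (perm_big _ (perm_to_rem yu)) big_cons/= -addrA -[X in X <= _]addr0.
apply: lerD; last first.
  apply: addr_ge0; first by apply: sumr_ge0 => i _; rewrite mulr_ge0.
  by apply: sumr_ge0 => i _; apply: sumr_ge0 => j _; rewrite mulr_ge0.
by rewrite ler_peMl// ler1n -mem_nbrs.
Qed.

(** If K^n(s, s) were larger than rho^n, then K^(nj)(s, s), which is at least
    its j-th power, would grow faster than th'^(nj) for some th' > rho. By
    irreducibility so would the transition probabilities from x to y, against the
    definition of rho. *)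
Lemma kpow_le_rhoQ x y s n : (forall s t, valid s -> valid t -> reach s t) ->
  0 < rhoQ R x y -> valid s -> P n s s <= rhoQ R x y ^+ n.
Proof.
set rho := rhoQ R x y => irr rho0 vs; rewrite leNgt; apply/negP => ltP.
have n0 : (0 < n)%N.
  by case: n ltP => //; rewrite expr0 /= eqxx ltxx.
set ka := P n s s in ltP; have ka0 : 0 < ka by apply: lt_trans ltP; rewrite exprn_gt0.
pose th : R := ka `^ (n%:R^-1).
have thn : th ^+ n = ka.
  rewrite -powR_mulrn ?powR_ge0// -powRrM mulVf ?powRr1 ?(ltW ka0)//.
  by rewrite pnatr_eq0 -lt0n.
have rth : rho < th.
  rewrite ltNge; apply/negP => h; move: ltP; rewrite ltNge -thn => /negP; apply.
  by apply: lerXn2r; rewrite ?nnegrE ?powR_ge0// ltW.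
pose th' := (rho + th) / 2.
have rth' : rho < th' by rewrite /th'; lra.
have th'th : th' < th by rewrite /th'; lra.
have th'0 : 0 < th' := lt_trans rho0 rth'.
have [n0' _ evP] := rhoQ_lt_eventually rth'.
have nbr v : exists z, z \in nbrs v.
  have : (0 < deg v)%N by exact: leq_trans (deg2 v).
  rewrite deg_nbrs// lt0n sum_nat_seq_neq0 => /hasP[w vw _]; by exists w.
have [z xz] := nbr x; have [u yu] := nbr y.
have [c c0 cP] := kpow_le_nbrw xz yu.
have [l1 w1] : reach (x, z) s by apply: irr => //; rewrite /valid -mem_nbrs.
have [l2 w2] : reach s (u, y).
  by apply: irr => //; rewrite -valid_opp// /valid -mem_nbrs.
have P1 := (kpow_gt0_walk _ _ _).2 w1; have P2 := (kpow_gt0_walk _ _ _).2 w2.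
have K0 := kpow_ge0 (@pnext X) (pkernel_ge0 R deg2).
have pw j : ka ^+ j <= P (n * j)%N s s.
  elim: j => [|j IH]; first by rewrite muln0 expr0 /= eqxx.
  rewrite exprS mulnS; apply: le_trans (kpow_cat1 _ (pkernel_ge0 R deg2) _ _ _ s _).
  by apply: ler_wpM2l => //; exact: ltW.
pose V := ka / th' ^+ n.
have V1 : 1 < V.
  by rewrite ltr_pdivlMr ?exprn_gt0// mul1r -thn ltrXn2r ?(ltW th'0)// -lt0n.
pose d := c * (P l1 (x, z) s * P l2 s (u, y)).
have d0 : 0 < d by rewrite !mulr_gt0.
pose D := th' ^+ (l1 + l2).+1 / d.
have VD j : (n0' <= j)%N -> V ^+ j <= D.
  move=> n0j; rewrite /V /D expr_div_n -exprM ler_pdivrMr ?exprn_gt0//.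
  rewrite mulrAC ler_pdivlMr// -[X in _ <= X]exprD.
  have -> : ((l1 + l2).+1 + n * j = (l1 + n * j + l2).+1)%N.
    by rewrite addSn addnAC.
  apply: le_trans (evP (l1 + n * j + l2).+1 _); last first.
    apply: leq_trans n0j _; apply: leqW; apply: leq_trans (leq_addr _ _).
    by apply: leq_trans (leq_addl _ _); exact: leq_pmull.
  apply: le_trans (cP _); rewrite /d mulrCA ler_pM2l//.
  apply: le_trans (kpow_cat1 _ (pkernel_ge0 R deg2) _ _ _ s _).
  rewrite mulrA; apply: ler_wpM2r => //.
  apply: le_trans (kpow_cat1 _ (pkernel_ge0 R deg2) _ _ _ s _).
  by rewrite mulrC; apply: ler_wpM2l => //.
apply: (@exp_not_le_linear _ V D V1) => j.
apply: (@le_trans _ _ (V ^+ (n0' + j))).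
  by apply: ler_weXn2l; [exact: ltW|exact: leq_addl].
apply: (@le_trans _ _ D); first by apply: VD; exact: leq_addr.
by rewrite ler_peMr// ?ler1n// divr_ge0 ?exprn_ge0// ltW.
Qed.

End Rho.

(** * Conclusion *)

Lemma kpow_scale (R : realType) (T : eqType) (nb : T -> seq T)
    (w : T -> T -> R) (c : R) n s t :
  kpow nb (fun s t => w s t * c) n s t = kpow nb w n s t * c ^+ n.
Proof.
elim: n s => [|n IH] s /=; first by rewrite expr0 mulr1.
rewrite mulr_suml; apply: eq_bigr => r _; rewrite IH exprS; ring.
Qed.

Lemma cvg_sum0 (R : realType) (I : eqType) (r : seq I) (F : I -> nat -> R) :
  {in r, forall i, F i @ \oo --> (0 : R)} ->
  (fun n => \sum_(i <- r) F i n) @ \oo --> (0 : R).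
Proof.
elim: r => [|i r IH] Fr.
  by under eq_fun do rewrite big_nil; exact: cvg_cst.
under eq_fun do rewrite big_cons.
suff : (fun n => F i n + \sum_(j <- r) F j n) @ \oo --> (0 + 0 : R).
  by rewrite addr0.
apply: cvgD.
  by apply: Fr; rewrite mem_head.
by apply: IH => j jr; apply: Fr; rewrite inE jr orbT.
Qed.

Lemma infinite_set_injection (T : choiceType) (A : set T) : infinite_set A ->
  exists2 f : nat -> T, injective f & forall n, A (f n).
Proof.
move=> /infiniteP/card_leP/unsquash f.
exists (fun n => val (f (to_setT n))); last by move=> n; exact: set_valP.
move=> i j /val_inj fij.
have := @inj _ _ _ f (to_setT i) (to_setT j); rewrite !inE => /(_ I I fij).
by move=> /(congr1 val).
Qed.

Lemma infinite_aut_orbit (X : multigraph) : infinite_set [set: X] ->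
  almost_transitive X -> exists x : X, infinite_set (aut_orbit x).
Proof.
move=> Xinf atX; apply: contrapT => /forallNP fin; apply: Xinf.
apply: (@sub_finite_set _ _ (\bigcup_(O in range (@aut_orbit X)) O)).
  move=> x _; exists (aut_orbit x); first by exists x.
  by exists id => //; split => //; exists id.
apply: bigcup_finite => // _ [x _ <-]; exact: contrapT (fin x).
Qed.

Section Vanish.
Variables (R : realType) (X : multigraph).
Hypothesis Xinf : infinite_set [set: X].
Hypothesis Xlf : locally_finite X.
Hypothesis Xc : connected_graph X.
Hypothesis deg2 : forall z : X, (2 <= deg z)%N.
Hypothesis atX : almost_transitive X.
Variables (x0 y0 : X).
Local Notation rho := (rhoQ R x0 y0).
Hypothesis rho0 : 0 < rho.
Implicit Types (s t : X * X).
Local Notation P := (kpow (@pnext X) (@pkernel R X)).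

Lemma rho_irreducible s t : valid s -> valid t -> reach s t.
Proof.
apply: reach_all => //.
have [n _ n0] := rhoQ_gt0_frequently Xlf deg2 rho0 0%N.
have [m nm m0] := rhoQ_gt0_frequently Xlf deg2 rho0 n.+1.
have [|k kP] := closed_walk_of_two_lengths Xlf (nbrw_gt0_vwalk Xlf deg2 n0)
  (nbrw_gt0_vwalk Xlf deg2 m0) _; first by lia.
by exists k, x0.
Qed.

Lemma exists_nbr (v : X) : exists z, z \in nbrs v.
Proof.
have : (0 < deg v)%N by exact: leq_trans (deg2 v).
by rewrite deg_nbrs// lt0n sum_nat_seq_neq0 => /hasP[w vw _]; exists w.
Qed.

(** The pair s is chosen with source in an infinite orbit; the images of s
    under the automorphisms are then infinitely many pairs with the same
    diagonal powers. *)
Lemma exists_diag_vanish : exists2 s, valid s &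
  (fun n => P n s s / rho ^+ n) @ \oo --> (0 : R).
Proof.
have [x xinf] := infinite_aut_orbit Xinf atX.
have [z xz] := exists_nbr x; pose s := (x, z).
have vs : valid s by rewrite /valid -mem_nbrs.
exists s => //.
pose S := [set map_pair h s | h in @automorphism X].
have Sinf : infinite_set (S `\ s).
  move=> finS; apply: xinf.
  have finS1 : finite_set (s |` (S `\ s)) by rewrite finite_setU.
  have := finite_image fst finS1.
  apply: sub_finite_set => _ [h ah ->].
  exists (map_pair h s) => //.
  by have [->|/eqP hs] := eqVneq (map_pair h s) s; [left|right; split => //; exists h].
have [f finj fS] := infinite_set_injection Sinf.
pose q s t : R := pkernel R s t / rho.
have q0 s' t' : 0 <= q s' t' by rewrite divr_ge0 ?(pkernel_ge0 R deg2)// ltW.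
have qE n s' t' : kpow (@pnext X) q n s' t' = P n s' t' / rho ^+ n.
  by rewrite kpow_scale exprVn.
have fv i : valid (f i).
  have [[h ah <-] _] := fS i; rewrite /valid /=.
  by case: ah => _ ->.
have qreach s' t' : valid s' -> valid t' ->
    exists n, 0 < kpow (@pnext X) q n s' t'.
  move=> vs' vt'; have [n w] := rho_irreducible vs' vt'; exists n.
  by rewrite qE divr_gt0 ?exprn_gt0//; apply/kpow_gt0_walk.
have := @kpow_vanish R _ (@pnext X) q q0 s f finj.
under eq_fun do rewrite qE.
apply.
- by move=> i; have [_ /eqP] := fS i; rewrite eq_sym.
- by move=> i n; have [[h ah <-] _] := fS i; rewrite !qE automorphism_kpow.
- move=> n; rewrite qE ler_pdivrMr ?exprn_gt0// mul1r.
  by apply: kpow_le_rhoQ => //; exact: rho_irreducible.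
- by move=> i; exact: qreach.
- by move=> i; exact: qreach.
Qed.

(** Complete a walk from s to t to a closed walk at r, by fixed walks. *)
Lemma pair_vanish s t : valid s -> valid t ->
  (fun n => P n s t / rho ^+ n) @ \oo --> (0 : R).
Proof.
move=> vs vt; have [r vr r0] := exists_diag_vanish.
have [l1 w1] := rho_irreducible vr vs; have [l2 w2] := rho_irreducible vt vr.
have P1 := (kpow_gt0_walk R Xlf deg2 _ _ _).2 w1.
have P2 := (kpow_gt0_walk R Xlf deg2 _ _ _).2 w2.
have K0 := kpow_ge0 (@pnext X) (pkernel_ge0 R deg2).
pose l := (l1 + l2)%N.
pose C := rho ^+ l / (P l1 r s * P l2 t r).
have : (fun n => C * (P (n + l)%N r r / rho ^+ (n + l))) @ \oo --> (0 : R).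
  rewrite -(mulr0 C); apply: cvgMr.
  by rewrite (cvg_shiftn l (fun n => P n r r / rho ^+ n)).
apply: (squeeze_cvgr _ (cvg_cst 0)); apply: nearW => n.
rewrite divr_ge0 ?exprn_ge0 ?(ltW rho0)//=.
rewrite /C exprD; have rl : 0 < rho ^+ l by rewrite exprn_gt0.
have rn : 0 < rho ^+ n by rewrite exprn_gt0.
have PP : 0 < P l1 r s * P l2 t r by rewrite mulr_gt0.
have -> : rho ^+ l / (P l1 r s * P l2 t r) * (P (n + l)%N r r / (rho ^+ n * rho ^+ l))
    = P (n + l)%N r r / (P l1 r s * P l2 t r) / rho ^+ n.
  by field; rewrite !gt_eqF.
rewrite ler_pM2r ?invr_gt0// ler_pdivlMr//.
have -> : (n + l = l1 + n + l2)%N by rewrite /l addnA (addnC n).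
apply: le_trans (kpow_cat1 _ (pkernel_ge0 R deg2) _ _ _ t _).
rewrite mulrA; apply: ler_wpM2r => //.
rewrite mulrC; exact: kpow_cat1 (pkernel_ge0 R deg2) _ _ _ _ _.
Qed.

Lemma nbrw_vanish (x y : X) : nbrw R n x y / rho ^+ n @[n --> \oo] --> (0 : R).
Proof.
rewrite -(cvg_shiftS (fun n => nbrw R n x y / rho ^+ n)).
pose F z u n : R := (nedges x z)%:R * (P n (x, z) (u, y) / rho ^+ n).
pose C : R := (deg x)%:R^-1 / rho.
have FE n : nbrw R n.+1 x y / rho ^+ n.+1 =
    C * \sum_(z <- nbrs x) \sum_(u <- nbrs y) F z u n.
  rewrite nbrw_pairs// exprS invfM /C -!mulrA; congr (_ * _).
  rewrite mulrCA; congr (_ * _); rewrite mulr_suml; apply: eq_bigr => z _.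
  by rewrite mulr_suml; apply: eq_bigr => u _; rewrite /F mulrA.
have F0 : (fun n => \sum_(z <- nbrs x) \sum_(u <- nbrs y) F z u n)
    @ \oo --> (0 : R).
  apply: (@cvg_sum0 _ _ _ (fun z n => \sum_(u <- nbrs y) F z u n)) => z xz.
  apply: (@cvg_sum0 _ _ _ (F z)) => u yu.
  have vs : valid (x, z) by rewrite /valid -mem_nbrs.
  have vt : valid (u, y) by rewrite /valid/= nedges_sym// -mem_nbrs.
  have := cvgM (cvg_cst ((nedges x z)%:R : R)) (pair_vanish vs vt).
  rewrite mulr0; apply.
by rewrite (funext FE); have := cvgM (cvg_cst C) F0; rewrite mulr0; apply.
Qed.

End Vanish.

(* rho(Q) does not depend on the pair of vertices used to compute it, so it is
   computed at an arbitrary pair (x0, y0). When rho(Q) = 0 the convention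
   a / 0 = 0 covers the tree case. *)
Theorem theorem1p5 (R : realType) (X : multigraph)
    (X_infinite : infinite_set [set: X])
    (X_locally_finite : locally_finite X)
    (X_connected : connected_graph X)
    (X_deg_ge2 : forall x : X, (2 <= deg x)%N)
    (X_almost_transitive : almost_transitive X)
    (x0 y0 x y : X) :
  nbrw R n x y / rhoQ R x0 y0 ^+ n @[n --> \oo] --> (0 : R).
Proof.
set rho := rhoQ R x0 y0.
have [rho0|rho0] := ltP 0 rho; first exact: nbrw_vanish.
have {rho0} -> : rho = 0.
  by apply/eqP; rewrite eq_le rho0 rhoQ_ge0.
apply: (@cvg_near_cst _ R^o); exists 1%N => // -[//|n] _ /=.
by rewrite expr0n invr0 mulr0.
Qed.
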